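(* Let $X=(X_s)_{s\in[0,T]}$ be a centered continuous Gaussian process with covariance function $R_X(s,t)=\mathbb E X_sX_t$, generated by a linear bounded operator $u:H\to C([0,T])$ on a separable Hilbert space $H$. Let $A\subset C([0,T])^*$ be a finite set of $N$ conditions, $X^{(A)}$ the conditioned process of $X$ with respect to $A$, and $R_{X^{(A)}}$ its covariance function. Let $(e_i)_{i=1}^N$ be an orthonormal basis of the detached subspace $H_{(A)}$. Then for all $s,t\in[0,T]$ $$R_{X^{(A)}}(s,t)=R_X(s,t)-\sum_{i=1}^N (ue_i)(s)\,(ue_i)(t).$$
   Context: $C([0,T])$ is the Banach space of continuous real functions on $[0,T]$ with the supremum norm; a condition is an element $a$ of $C([0,T])^*$ (a finite signed Borel measure, $a(f)=\int f\,da$). ''$X$ is generated by $u$'' means that for every orthonormal basis $(h_i)_{i\ge1}$ of $H$ and independent standard normal $(\omega_i)_{i\ge1}$, the series $\sum_i\omega_i(uh_i)$ converges almost surely in $C([0,T])$ and has the law of $X$. Reduced Hilbert space: $H^{(A)}=\{h\in H: a(uh)=0\text{ for all }a\in A\}$. Detached subspace: $H_{(A)}=H\ominus H^{(A)}$ (orthogonal complement), which equals $\operatorname{span}\{u^*a:a\in A\}$, where $u^*:C([0,T])^*\to H$ is the adjoint, $\langle u^*a,h\rangle=a(uh)$. If $\dim H_{(A)}<N$, the convention is that an orthonormal basis of $H_{(A)}$ is padded by zero vectors to a list $e_1,\dots,e_N$. The conditioned process $X^{(A)}$ (defined only in law) is a continuous Gaussian process such that for all $b_1,\dots,b_n\in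 C([0,T])^*$ the law of $(b_1(X^{(A)}),\dots,b_n(X^{(A)}))$ is the conditional law of the Gaussian vector $(b_1(X),\dots,b_n(X))$ given $a(X)=0$ for all $a\in A$ in the sense of Gaussian conditioning, i.e. the law of $\big(b_k(X)-\mathbb E[b_k(X)\mid a(X),a\in A]\big)_{k=1}^n$. *)

(* Defs.v *)
From HB Require Import structures.
From mathcomp Require Import all_boot all_order all_algebra finmap.
From mathcomp Require Import all_classical all_reals all_analysis.

Set Implicit Arguments.
Unset Strict Implicit.
Unset Printing Implicit Defensive.

Import Order.TTheory GRing.Theory Num.Theory.
Import numFieldNormedType.Exports.

Local Open Scope classical_set_scope.
Local Open Scope ring_scope.

HB.mixin Record CompleteNormedModule_isHilbert (R : realType) H
    & CompleteNormedModule R H := {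
  inner : H -> H -> R ;
  innerC : forall x y, inner x y = inner y x ;
  innerDl : forall x y z, inner (x + y) z = inner x z + inner y z ;
  innerZl : forall (c : R) x y, inner (c *: x) y = c * inner x y ;
  inner_norm : forall x, inner x x = `|x| ^+ 2
}.

#[short(type="hilbertType")]
HB.structure Definition Hilbert (R : realType) :=
  {H of CompleteNormedModule R H & CompleteNormedModule_isHilbert R H}.

Definition separable (H : topologicalType) : Prop :=
  exists2 D : set H, countable D & dense D.

Section hilbert.
Context {R : realType} {H : hilbertType R}.

Definition orthocompl (V : set H) : set H :=
  [set g | forall h, V h -> inner g h = 0].

Definition lin_span (V : set H) : set H :=
  [set x | exists n (c : 'I_n -> R) (v : 'I_n -> H),
    (forall i, V (v i)) /\ x = \sum_(i < n) c i *: v i].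

(* An orthonormal family, possibly padded at its end by zero vectors: this
   gives families indexed by 'I_N, resp. by nat, for subspaces of dimension
   at most N, resp. for all separable spaces. *)
Definition padded_orthonormal {d : Order.disp_t} {I : porderType d}
    (e : I -> H) : Prop :=
  [/\ forall i j, i != j -> inner (e i) (e j) = 0,
      forall i, inner (e i) (e i) = 1 \/ e i = 0 &
      forall i j, (i <= j)%O -> e i = 0 -> e j = 0].

Definition orthonormal_basis {d : Order.disp_t} {I : porderType d}
    (V : set H) (e : I -> H) : Prop :=
  padded_orthonormal e /\ closure (lin_span (range e)) = V.

End hilbert.

Definition cont_on {R : realType} (T : R) : {pred `[0, T]%classic -> R} :=
  mem [set f : `[0, T]%classic -> R | continuous f].

Record C0 (R : realType) (T : R) := MkC0 {
  C0_fun :> `[0, T]%classic -> R ;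
  C0P : C0_fun \in @cont_on R T
}.

Section C0_normed.
Context {R : realType} (T : R).
Local Notation K := `[0, T]%classic.
Local Notation C := (C0 T).
Implicit Types f g : C.

HB.instance Definition _ := [isSub for (@C0_fun R T)].
HB.instance Definition _ := [Choice of C by <:].

Lemma cont_on_submod_closed : submod_closed (@cont_on R T).
Proof.
split; first by apply/mem_set => /= x; exact: (@cst_continuous _ _ (0 : R)).
move=> a f g /set_mem cf /set_mem cg; apply/mem_set => x.
apply: (@continuousD R R^o); last exact: cg.
by apply: (@continuousZl_tmp R R^o); exact: cf.
Qed.
HB.instance Definition _ := GRing.isSubmodClosed.Build _ _ (@cont_on R T)
  cont_on_submod_closed.
HB.instance Definition _ := [SubChoice_isSubLmodule of C by <:].

Definition sup_norm f : R := sup (range (fun x => `|f x|)).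

Lemma C0_cts f : continuous f.
Proof. by have /set_mem := C0P f. Qed.

Lemma C0_bounded f : has_ubound (range (fun x => `|f x|)).
Proof.
have /subspace_valL_continuousP cf := @C0_cts f.
have := compact_bounded (continuous_compact cf (@segment_compact R 0 T)).
move=> /pinfty_ex_gt0[M _ fM]; exists M => _ [x _ <-].
apply: (fM (f x)); exists (set_val x); first exact: set_valP.
by have /(congr1 (@^~ x)) := valLK point f.
Qed.

Lemma sup_norm_ge f x : `|f x| <= sup_norm f.
Proof. by apply: ub_le_sup; [exact: C0_bounded|exists x]. Qed.

Lemma sup_norm_le f M : 0 <= M -> (forall x, `|f x| <= M) -> sup_norm f <= M.
Proof.
move=> M0 fM; have [[x0 _]|K0] := pselect (exists x : K, True).
  apply: ge_sup; first by exists `|f x0|; exists x0.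
  by move=> _ [x _ <-].
have r0 : range (fun x => `|f x|) = set0.
  by rewrite -subset0 => r [x _ _]; apply: K0; exists x.
by rewrite /sup_norm r0 sup0.
Qed.

Lemma sup_norm_ge0 f : 0 <= sup_norm f.
Proof.
have [[x _]|K0] := pselect (exists x : K, True).
  exact: le_trans (normr_ge0 _) (sup_norm_ge f x).
have r0 : range (fun x => `|f x|) = set0.
  by rewrite -subset0 => r [x _ _]; apply: K0; exists x.
by rewrite /sup_norm r0 sup0.
Qed.

Lemma sup_normD f g : sup_norm (f + g) <= sup_norm f + sup_norm g.
Proof.
apply: sup_norm_le => [|x]; first by rewrite addr_ge0// sup_norm_ge0.
by rewrite (le_trans (ler_normD _ _))// lerD// sup_norm_ge.
Qed.

Lemma sup_normZ (l : R) f : sup_norm (l *: f) = `|l| * sup_norm f.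
Proof.
have le_ (a : R) g : sup_norm (a *: g) <= `|a| * sup_norm g.
  apply: sup_norm_le => [|x]; first by rewrite mulr_ge0// sup_norm_ge0.
  by rewrite (_ : (a *: g) x = a * g x)// normrM ler_wpM2l// sup_norm_ge.
apply/eqP; rewrite eq_le le_//=.
have [->|l0] := eqVneq l 0; first by rewrite normr0 mul0r sup_norm_ge0.
have := le_ l^-1 (l *: f); rewrite scalerA mulVf// scale1r normfV.
by rewrite -ler_pdivlMl ?invr_gt0 ?normr_gt0// invrK.
Qed.

Lemma sup_norm0_eq0 f : sup_norm f = 0 -> f = 0.
Proof.
move=> f0; apply/val_inj/funext => x /=.
by apply/normr0_eq0/le_anti; rewrite normr_ge0 -f0 sup_norm_ge.
Qed.

HB.instance Definition _ := @Lmodule_isNormed.Build R C sup_norm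
  sup_normD sup_normZ sup_norm0_eq0.

End C0_normed.

Definition C0_dual {R : realType} (T : R) : set (C0 T -> R) :=
  [set a : C0 T -> R | scalar a /\ continuous a].
Arguments C0_dual {R} T.

Definition C0_borel {R : realType} (T : R) : set (set (C0 T)) :=
  <<s [set U : set (C0 T) | open U] >>.

Section processes.
Context {R : realType} {T : R} {d : measure_display} {Omega : measurableType d}.
Variable P : probability Omega R.

(* normal_prob m 0 is not a Dirac mass in the library, hence the case split. *)
Definition gaussian_rv (Y : Omega -> R) : Prop :=
  measurable_fun [set: Omega] Y /\
  exists m s : R, 0 <= s /\ forall B : set R, measurable B ->
    P (Y @^-1` B) = if s == 0 then \d_m B else normal_prob m s B.

(* Path continuity is carried by the codomain of X. *)
Definition gaussian_process (X : Omega -> C0 T) : Prop :=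
  forall n (c : 'I_n -> R) (t : 'I_n -> `[0, T]%classic),
    gaussian_rv (fun w => \sum_(i < n) c i * X w (t i)).

Definition centered (X : Omega -> C0 T) : Prop :=
  forall s : `[0, T]%classic, ('E_P[fun w => X w s] = 0)%E.

Definition covariance_function (X : Omega -> C0 T)
    (s t : `[0, T]%classic) : \bar R :=
  ('E_P[fun w => (X w s * X w t)%R])%E.

Definition independent_seq (om : nat -> Omega -> R) : Prop :=
  forall (J : {fset nat}) (B : nat -> set R), (forall i, measurable (B i)) ->
    P (\bigcap_(i in [set` J]) (om i @^-1` B i)) =
    (\prod_(i <- J) P (om i @^-1` B i))%E.

Definition independent_standard_normal (om : nat -> Omega -> R) : Prop :=
  [/\ forall i, measurable_fun [set: Omega] (om i),
      forall i (B : set R), measurable B ->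
        P (om i @^-1` B) = normal_prob 0 1 B &
      independent_seq om].

(* Z is a version of E[Y | G] for a sub-sigma-algebra G. *)
Definition is_cond_exp (G : set (set Omega)) (Y Z : Omega -> R) : Prop :=
  [/\ forall B : set R, measurable B -> G (Z @^-1` B),
      P.-integrable [set: Omega] (EFin \o Z) &
      forall E, G E -> (\int[P]_(w in E) (Z w)%:E = \int[P]_(w in E) (Y w)%:E)%E].

Definition sigma_of_conditions (X : Omega -> C0 T) (A : set (C0 T -> R)) :
    set (set Omega) :=
  <<s [set E | exists a (B : set R),
        [/\ A a, measurable B & E = (a \o X) @^-1` B]] >>.

End processes.

Definition generated_by {R : realType} {T : R} {H : hilbertType R}
    {d : measure_display} {Omega : measurableType d} (P : probability Omega R)
    (X : Omega -> C0 T) (u : H -> C0 T) : Prop :=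
  forall h : nat -> H, orthonormal_basis [set: H] h ->
  forall (d' : measure_display) (Omega' : measurableType d')
    (P' : probability Omega' R) (om : nat -> Omega' -> R),
  independent_standard_normal P' om ->
  exists S : Omega' -> C0 T,
    [/\ forall B, C0_borel B -> measurable (S @^-1` B),
        {ae P', forall w,
          series (fun i => om i w *: u (h i)) @ \oo --> S w} &
        forall B, C0_borel B -> P' (S @^-1` B) = P (X @^-1` B)].

Section reduction.
Context {R : realType} {T : R} {H : hilbertType R}.
Variables (u : H -> C0 T) (A : set (C0 T -> R)).

Definition reduced_space : set H := [set h | forall a, A a -> a (u h) = 0].

Definition detached_space : set H := orthocompl reduced_space.

End reduction.

(* Conditional expectations are determined up to null sets, so the law of the
   vector of residuals does not depend on the chosen versions Z k. *)
Definition conditioned_process {R : realType} {T : R}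
    {d : measure_display} {Omega : measurableType d} (P : probability Omega R)
    (X : Omega -> C0 T) (A : set (C0 T -> R))
    {d' : measure_display} {Omega' : measurableType d'}
    (P' : probability Omega' R) (Y : Omega' -> C0 T) : Prop :=
  gaussian_process P' Y /\
  forall n (b : 'I_n -> C0 T -> R), (forall k, C0_dual T (b k)) ->
  forall Z : 'I_n -> Omega -> R,
  (forall k, is_cond_exp P (sigma_of_conditions X A) (b k \o X) (Z k)) ->
  forall B : set (n.-tuple R), measurable B ->
    P' ((fun w => [tuple b k (Y w) | k < n]) @^-1` B) =
    P ((fun w => [tuple b k (X w) - Z k w | k < n]) @^-1` B).

(* Main.v *)
(** For an orthonormal basis [h] of [H] and i.i.d. standard normals [om], [X] has
the law of [\sum_i om_i (u h_i)].  Flipping the sign of some [h_i] gives another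
orthonormal basis, so this series and its reflection, which live on the same
probability space, have the same law: every integrable functional of [X] that is
odd under such a reflection has mean zero.

Choose [h] as an enumeration of the nonzero [e_i] followed by an orthonormal
family of the reduced space, and let [L_i] be the linear combination of conditions
with [L_i (u x) = <e_i, x>].  Put [Z_t = \sum_i (u e_i)(t) L_i(X)] and
[W_t = X_t - Z_t].  Reflecting the reduced space changes the sign of [W_t] and
preserves all conditions; hence [Z_t] is the conditional expectation of [X_t] and
[W] is orthogonal to [Z].  Reflecting a single [e_i] gives [E (L_i L_j) = 0] for
[j != i], and [L_i(X)] is standard normal when [e_i != 0].  So the covariance of
[W], which is that of the conditioned process, is the covariance of [X] minus that
of [Z].

The hypothesis on [X] is void unless i.i.d. standard normals exist.  They are
built from the binary digits of a uniform variable, splitting the digits into even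
and odd positions and iterating. *)

Require Import Defs.
From HB Require Import structures.
From mathcomp Require Import all_boot all_order all_algebra finmap.
From mathcomp Require Import all_classical all_reals all_analysis.
From mathcomp Require Import measurable_realfun ring lra.

Set Implicit Arguments.
Unset Strict Implicit.
Unset Printing Implicit Defensive.

Import Order.TTheory GRing.Theory Num.Theory.
Import numFieldNormedType.Exports.

Local Open Scope classical_set_scope.
Local Open Scope ring_scope.

(** * Hilbert spaces *)

Section scalar_functions.
Context {R : realType} {V : lmodType R} (l : V -> R).
Hypothesis sl : scalar l.

Lemma scalar_fun0 : l 0 = 0.
Proof.
have := sl 1 0 0; rewrite scaler0 addr0 mul1r => /eqP.
by rewrite -subr_eq subrr eq_sym => /eqP.
Qed.

Lemma scalar_funD x y : l (x + y) = l x + l y.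
Proof. by have := sl 1 x y; rewrite scale1r mul1r. Qed.

Lemma scalar_funZ c x : l (c *: x) = c * l x.
Proof. by have := sl c x 0; rewrite scalar_fun0 !addr0. Qed.

Lemma scalar_funB x y : l (x - y) = l x - l y.
Proof. by rewrite -scaleN1r scalar_funD scalar_funZ mulN1r. Qed.

Lemma scalar_fun_sum I (r : seq I) (P : pred I) (f : I -> V) :
  l (\sum_(i <- r | P i) f i) = \sum_(i <- r | P i) l (f i).
Proof. by apply: (big_morph l scalar_funD scalar_fun0). Qed.

End scalar_functions.

Lemma bounded_scalar_continuous (R : realType) (W : normedModType R)
  (l : W -> R) (M : R) : scalar l ->
  (forall x, `|l x| <= M * `|x|) -> continuous l.
Proof.
move=> sl lM x; apply/cvgrPdist_le => e e0.
(* [M] may be zero or negative, so a positive constant above it is used. *)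
have M0 : 0 < `|M| + 1 by rewrite ltr_wpDl.
near=> y.
rewrite -scalar_funB// (le_trans (lM _))// (@le_trans _ _ ((`|M| + 1) * `|x - y|))//.
  by rewrite ler_wpM2r// (le_trans (ler_norm _))// lerDl.
rewrite -ler_pdivlMl//.
near: y; apply: cvgr_dist_le => //.
by rewrite mulr_gt0 ?invr_gt0.
Unshelve. all: by end_near. Qed.

Section inner_product.
Context {R : realType} {H : hilbertType R}.
Implicit Types (x y z : H) (V : set H) (l : H -> R).

Lemma innerDr x y z : inner x (y + z) = inner x y + inner x z.
Proof. by rewrite innerC innerDl !(innerC x). Qed.

Lemma innerZr (c : R) x y : inner x (c *: y) = c * inner x y.
Proof. by rewrite innerC innerZl innerC. Qed.

Lemma inner0l x : inner 0 x = 0.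
Proof. by rewrite -(scale0r (0 : H)) innerZl mul0r. Qed.

Lemma inner0r x : inner x 0 = 0.
Proof. by rewrite innerC inner0l. Qed.

Lemma innerNl x y : inner (- x) y = - inner x y.
Proof. by rewrite -scaleN1r innerZl mulN1r. Qed.

Lemma innerBl x y z : inner (x - y) z = inner x z - inner y z.
Proof. by rewrite innerDl innerNl. Qed.

Lemma innerBr x y z : inner x (y - z) = inner x y - inner x z.
Proof. by rewrite innerC innerBl !(innerC x). Qed.

Lemma inner_suml I (r : seq I) (P : pred I) (f : I -> H) x :
  inner (\sum_(i <- r | P i) f i) x = \sum_(i <- r | P i) inner (f i) x.
Proof.
by elim/big_rec2: _ => [|i a b _ <-]; rewrite ?inner0l// innerDl.
Qed.

Lemma inner_sumr I (r : seq I) (P : pred I) (f : I -> H) x :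
  inner x (\sum_(i <- r | P i) f i) = \sum_(i <- r | P i) inner x (f i).
Proof. by rewrite innerC inner_suml; under eq_bigr do rewrite innerC. Qed.

Lemma cauchy_schwarz x y : `|inner x y| <= `|x| * `|y|.
Proof.
have [->|y0] := eqVneq y 0; first by rewrite inner0r !normr0 mulr0.
have ny0 : 0 < `|y| by rewrite normr_gt0.
(* The residual of [x] after projection onto [y] has nonnegative squared norm. *)
have : 0 <= `|x - (inner x y / `|y| ^+ 2) *: y| ^+ 2 by rewrite sqr_ge0.
rewrite -inner_norm innerBl !innerBr !innerZl !innerZr (innerC y x) !inner_norm.
set c := inner x y; set p := `|x|; set q := `|y| => h.
rewrite -(@ler_pXn2r _ 2) ?nnegrE ?mulr_ge0 ?normr_ge0// real_normK ?num_real//.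
have q0 : q ^+ 2 != 0 by rewrite expf_eq0/= gt_eqF.
have q20 : 0 < q ^+ 2 by rewrite exprn_gt0.
have h2 : 0 <= p ^+ 2 - c ^+ 2 / q ^+ 2.
  by move: h; congr (_ <= _); field; exact: lt0r_neq0.
by rewrite exprMn -ler_pdivrMr// -subr_ge0.
Qed.

Lemma inner_scalar x : scalar (inner x).
Proof. by move=> c y z; rewrite innerDr innerZr. Qed.

Lemma inner_continuous x : continuous (inner x).
Proof.
by apply: (bounded_scalar_continuous (@inner_scalar x)) => y; exact: cauchy_schwarz.
Qed.

(** The kernel of a continuous linear functional is a closed subspace. *)
Lemma scalar_closure_lin_span l V x : scalar l -> continuous l ->
  (forall v, V v -> l v = 0) -> closure (lin_span V) x -> l x = 0.
Proof.
move=> sl cl lV Vx.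
have l0 : l 0 = 0 by exact: scalar_fun0.
have clo : closed (l @^-1` [set 0]).
  by apply: closed_comp => [y _|]; [exact: cl|exact: closed_eq].
have : lin_span V `<=` l @^-1` [set 0].
  move=> _ [n [c [v [Vv ->]]]] /=; rewrite scalar_fun_sum// big1// => i _.
  by rewrite scalar_funZ// lV ?mulr0.
by move=> /closure_subset/(_ _ Vx); rewrite -(closure_id _).1.
Qed.

End inner_product.

(** * Gram-Schmidt orthonormalization and adapted bases *)

Section orthonormal_families.
Context {R : realType} {H : hilbertType R}.
Implicit Types (g h v : nat -> H).

(** Since [0^-1 = 0], the zero vector stays zero, so linearly dependent inputs of Gram-Schmidt yield
    zeros. *)
Definition normalize (x : H) : H := `|x|^-1 *: x.

(** The recursion returns all earlier outputs, because each step projects on every one of them;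
    [gram_schmidtE] recovers the usual formula. *)
Fixpoint gs_seq v n : seq H :=
  if n is m.+1 then
    let s := gs_seq v m in
    rcons s (normalize (v m - \sum_(g <- s) inner (v m) g *: g))
  else [::].

Definition gram_schmidt v n := nth 0 (gs_seq v n.+1) n.

Lemma gram_schmidtE v n : gram_schmidt v n = normalize
  (v n - \sum_(i < n) inner (v n) (gram_schmidt v i) *: gram_schmidt v i).
Proof.
have sz k : size (gs_seq v k) = k by elim: k => //= k IH; rewrite size_rcons IH.
have st k i : (i < k)%N -> nth 0 (gs_seq v k) i = gram_schmidt v i.
  elim: k => // k IH; rewrite ltnS leq_eqVlt => /predU1P[->//|ik] /=.
  by rewrite nth_rcons sz ik IH.
rewrite {1}/gram_schmidt/= nth_rcons sz ltnn eqxx; congr (normalize (_ - _)).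
rewrite (big_nth 0) sz big_mkord; apply: eq_bigr => i _.
by rewrite st.
Qed.

(** Unlike in [padded_orthonormal], zeros may occur anywhere: Gram-Schmidt produces one at each
    linearly dependent input. *)
Definition orthonormal_or0 g :=
  (forall i j, i != j -> inner (g i) (g j) = 0) /\
  (forall i, inner (g i) (g i) = 1 \/ g i = 0).

Lemma normalize_unit x : inner (normalize x) (normalize x) = 1 \/ normalize x = 0.
Proof.
rewrite /normalize; have [->|x0] := eqVneq x 0; [right|left].
  by rewrite scaler0.
by rewrite innerZl innerZr inner_norm; field; rewrite normr_eq0.
Qed.

Lemma gram_schmidt_orthonormal v : orthonormal_or0 (gram_schmidt v).
Proof.
have gu i : inner (gram_schmidt v i) (gram_schmidt v i) = 1 \/ gram_schmidt v i = 0.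
  by rewrite gram_schmidtE; exact: normalize_unit.
split=> // i j.
wlog : i j / (j < i)%N.
  move=> W ij; have [ji|ji|E] := ltngtP i j; last by rewrite E eqxx in ij.
    by rewrite innerC; apply: W => //; rewrite eq_sym.
  exact: W.
move=> + _; move: j; elim/ltn_ind: i => i IH j ji.
have o k l : (k < i)%N -> (l < i)%N -> k != l ->
    inner (gram_schmidt v k) (gram_schmidt v l) = 0.
  move=> ki li kl; have [lk|lk|E] := ltngtP k l; last by rewrite E eqxx in kl.
    by rewrite innerC IH.
  exact: IH.
rewrite gram_schmidtE /normalize innerZl innerBl inner_suml.
rewrite (_ : inner (v i) _ - _ = 0) ?mulr0//.
(* By induction only the term of index [j] survives. It cancels the inner product of [v i] with the
   [j]-th output; both vanish if that output is zero. *)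
rewrite (bigD1 (Ordinal ji))//= big1.
  rewrite addr0 innerZl; have [->|->] := gu j; first by rewrite mulr1 subrr.
  by rewrite !inner0r mulr0 subrr.
move=> k /eqP kj; rewrite innerZl o ?mulr0//; apply/eqP => ?; apply: kj.
exact/val_inj.
Qed.

(** The residual of [v n] is its own norm times the [n]-th output, and this norm is the last
    coefficient, the projections being orthogonal to that output. *)
Lemma gram_schmidt_span v n :
  v n = \sum_(i < n.+1) inner (v n) (gram_schmidt v i) *: gram_schmidt v i.
Proof.
rewrite big_ord_recr/=; set g := gram_schmidt v; set s := \sum_(i < n) _.
have E : g n = normalize (v n - s) by exact: gram_schmidtE.
apply/eqP; rewrite addrC -subr_eq; apply/eqP.
have vr : inner (v n) (g n) = inner (v n - s) (g n).
  rewrite innerBl [X in _ = _ - X]inner_suml big1 ?subr0// => i _.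
  by rewrite innerZl (gram_schmidt_orthonormal v).1 ?mulr0// ltn_eqF.
rewrite vr E /normalize; have [->|x0] := eqVneq (v n - s) 0.
  by rewrite !scaler0.
rewrite innerZr inner_norm scalerA.
rewrite [X in X *: _](_ : _ = 1) ?scale1r//.
by field; rewrite normr_eq0.
Qed.

(** All projections vanish by induction, so an orthonormal start of the sequence, zeros allowed,
    survives unchanged. *)
Lemma gram_schmidt_id v N :
  (forall i j, (i < N)%N -> (j < N)%N -> i != j -> inner (v i) (v j) = 0) ->
  (forall i, (i < N)%N -> inner (v i) (v i) = 1 \/ v i = 0) ->
  forall i, (i < N)%N -> gram_schmidt v i = v i.
Proof.
move=> vo vu; elim/ltn_ind => i IH iN.
rewrite gram_schmidtE big1 => [|j _].
  rewrite subr0 /normalize; have [|->] := vu i iN; last by rewrite scaler0.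
  rewrite inner_norm => /eqP; rewrite sqrp_eq1// => /eqP ->.
  by rewrite invr1 scale1r.
have jN : (j < N)%N by exact: ltn_trans iN.
by rewrite IH// vo ?scale0r// gtn_eqF.
Qed.

(** The position that the [n]-th term takes once the zeros before it are deleted. *)
Definition rank_lt g n := count (fun i => g i != 0) (iota 0 n).

Lemma rank_ltS g n : rank_lt g n.+1 = (rank_lt g n + (g n != 0)%R)%N.
Proof. by rewrite /rank_lt -addn1 iotaD count_cat/= add0n addn0. Qed.

Lemma rank_lt_le g m n : (m <= n)%N -> (rank_lt g m <= rank_lt g n)%N.
Proof.
move=> mn; rewrite -(subnK mn); elim: (n - m)%N => // k IH.
by rewrite addSn rank_ltS (leq_trans IH)// leq_addr.
Qed.

Lemma rank_lt_inj g m n : g m != 0 -> g n != 0 ->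
  rank_lt g m = rank_lt g n -> m = n.
Proof.
move=> gm gn E; have [mn|nm|//] := ltngtP m n.
  by have := rank_lt_le g mn; rewrite rank_ltS gm E addn1 ltnn.
by have := rank_lt_le g nm; rewrite rank_ltS gn E addn1 ltnn.
Qed.

(** Gram-Schmidt may leave zeros in the middle, whereas a padded family has them only at its end. So
    [h k] is the [k]-th nonzero term, or 0 if there is none. *)
Lemma orthonormal_drop0 g : orthonormal_or0 g -> exists h,
  [/\ padded_orthonormal h, forall k, h k = 0 \/ exists n, h k = g n &
      forall n, g n != 0 -> exists k, h k = g n].
Proof.
move=> [go gu].
pose S k := [set n | g n != 0 /\ rank_lt g n = k].
pose h k : H := if pselect (exists n, S k n) is left p then g (projT1 (cid p)) else 0.
have hP k : h k = 0 /\ (forall n, ~ S k n) \/ exists2 n, S k n & h k = g n.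
  rewrite /h; case: pselect => [p|np]; [right|left].
    by exists (projT1 (cid p)) => //; exact: projT2 (cid p).
  by split=> // n Sn; apply: np; exists n.
exists h; split; last first.
- move=> n gn; exists (rank_lt g n).
  have [[_ /(_ n)]|[m [gm E] ->]] := hP (rank_lt g n); first by case.
  by rewrite (rank_lt_inj gm gn E).
- by move=> k; have [[-> _]|[n _ ->]] := hP k; [left|right; exists n].
split.
- move=> i j ij; have [[-> _]|[n [_ ni] ->]] := hP i; first by rewrite inner0l.
  have [[-> _]|[m [_ mj] ->]] := hP j; first by rewrite inner0r.
  by apply: go; apply: contra_neq ij => nm; rewrite -ni -mj nm.
- by move=> i; have [[-> _]|[n _ ->]] := hP i; [right|exact: gu].
move=> i j ij hi.
have {}hi : forall n, ~ S i n.
  by have [[_ //]|[n [gn _] E]] := hP i; rewrite -E hi eqxx in gn.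
have [[-> _]//|[n [gn nj] _]] := hP j; exfalso.
(* Ranks grow by at most one at each step, so a rank that no nonzero term has is never exceeded. *)
have : forall m, (rank_lt g m <= i)%N.
  elim=> [//|m IH]; rewrite rank_ltS.
  have [|gm] := eqVneq (g m) 0; first by rewrite addn0.
  move: IH; rewrite leq_eqVlt => /predU1P[E|]; last by rewrite addn1.
  by have := hi m; case.
move=> /(_ n.+1); rewrite rank_ltS gn nj addn1 => ji.
by have := leq_trans ji ij; rewrite ltnn.
Qed.

(** Zero vectors, possibly outside [V], are traded for some element of [V] with coefficient 0. *)
Lemma lin_span_sub (V : set H) n (c : 'I_n -> R) (v : 'I_n -> H) :
  (forall i, v i = 0 \/ V (v i)) -> (exists x, V x) ->
  lin_span V (\sum_i c i *: v i).
Proof.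
move=> vV [x0 Vx0].
exists n, (fun i => if v i == 0 then 0 else c i), (fun i => if v i == 0 then x0 else v i).
split=> [i|]; first by case: eqVneq (vV i) => // /eqP vi [/vi|].
by apply: eq_bigr => i _; case: eqVneq => // ->; rewrite scaler0 scale0r.
Qed.

Lemma countable_range (T : pointedType) (D : set T) : countable D ->
  exists f : nat -> T, D `<=` range f.
Proof.
move=> /countable_injP[f fi].
exists (fun n => xget point [set x | D x /\ f x = n]) => x Dx.
exists (f x) => //=; case: xgetP => [y _ [Dy fy]|/(_ x)]; last by case.
by apply: fi; rewrite ?inE.
Qed.

(** Gram-Schmidt is run on [e] followed by a dense sequence, and the zeros are dropped. The vectors
    [e i] come out unchanged, the others are orthogonal to them, and density makes the span
    dense. *)
Lemma adapted_basis N (e : 'I_N -> H) : separable H -> padded_orthonormal e ->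
  exists h : nat -> H, [/\ orthonormal_basis [set: H] h,
    forall k, (exists i, h k = e i) \/ (forall i, inner (e i) (h k) = 0) &
    forall i, e i != 0 -> exists k, h k = e i].
Proof.
move=> [D cD dD] [eo eu _].
have [d Dd] := countable_range cD.
pose v n := if insub n is Some i then e i else d (n - N)%N.
have vlt (i : 'I_N) : v i = e i by rewrite /v valK.
have vge n : v (n + N)%N = d n by rewrite /v insubF ?addnK// ltnNge leq_addl.
have gid (i : 'I_N) : gram_schmidt v i = e i.
  rewrite -vlt; apply: (@gram_schmidt_id _ N) => // j.
    move=> k jN kN jk; rewrite (vlt (Ordinal jN)) (vlt (Ordinal kN)).
    by apply: eo; apply: contra_neq jk => /(congr1 val).
  by move=> jN; rewrite (vlt (Ordinal jN)).
have go := gram_schmidt_orthonormal v.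
have [h [hpad hg gh]] := orthonormal_drop0 go.
have hspan n : lin_span (range h) (v n).
  rewrite gram_schmidt_span; apply: lin_span_sub; last by exists (h 0%N), 0%N.
  move=> i; have [->|/gh[k <-]] := eqVneq (gram_schmidt v i) 0; first by left.
  by right; exists k.
exists h; split.
- split=> //; rewrite -subTset => x _ B Bx.
  have [|y [By /Dd[n _ E]]] := dD B^° _ (open_interior B).
    by exists x; exact: Bx.
  by exists y; split; [rewrite -E -vge|exact: interior_subset].
- move=> k; have [->|[n ->]] := hg k; first by right=> i; rewrite inner0r.
  have [nN|nN] := ltnP n N; first by left; exists (Ordinal nN); rewrite -gid.
  right=> i; rewrite -gid go.1// ltn_eqF//.
  exact: leq_trans (ltn_ord i) nN.
- by move=> i; rewrite -gid => /gh.
Qed.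

End orthonormal_families.

(** * Riesz representation *)

Section riesz.
Context {R : realType}.

(** Continuity at 0 with tolerance 1 gives a radius [d]; every nonzero vector is rescaled to norm
    [d / 2]. *)
Lemma scalar_continuous_bounded (W : normedModType R) (l : W -> R) :
  scalar l -> continuous l -> exists M, forall x, `|l x| <= M * `|x|.
Proof.
move=> sl cl.
have /cvgrPdist_le/(_ 1 ltr01)/nbhs_ballP[d /= d0 dl] := cl 0.
exists (2 / d) => x; have [->|x0] := eqVneq x 0.
  by rewrite scalar_fun0// !normr0 mulr0.
have nx : 0 < `|x| by rewrite normr_gt0.
have /dl : ball (0 : W) d ((d / 2 / `|x|) *: x).
  rewrite -ball_normE/= sub0r normrN normrZ ger0_norm ?divr_ge0 ?ltW//.
  by rewrite divfK ?gt_eqF// ltr_pdivrMr// ltr_pMr// ltr1n.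
rewrite /= scalar_fun0// sub0r normrN scalar_funZ// normrM ger0_norm; last first.
  by rewrite ?divr_ge0 ?ltW.
rewrite -ler_pdivlMl ?divr_gt0// => /le_trans; apply.
by rewrite mulr1 invf_div invf_div mulrC.
Qed.

Context {H : hilbertType R}.

(** Pythagoras. A zero [h i] must carry a zero coefficient, or it would count only on the right. *)
Lemma inner_sum_orthonormal (h : nat -> H) (c : nat -> R) m n :
  orthonormal_or0 h -> (forall i, h i = 0 -> c i = 0) ->
  `|\sum_(m <= i < n) c i *: h i| ^+ 2 = \sum_(m <= i < n) c i ^+ 2.
Proof.
move=> [ho hu] c0; rewrite -inner_norm inner_suml.
rewrite [LHS]big_nat_cond [RHS]big_nat_cond.
apply: eq_bigr => i /andP[mni _]; rewrite innerZl inner_sumr.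
rewrite (bigD1_seq i)/= ?mem_index_iota ?iota_uniq// big1 ?addr0.
  rewrite innerZr; have [->|/c0->] := hu i; last by rewrite !mul0r expr2 mulr0.
  by rewrite mulr1 expr2.
by move=> j ji; rewrite innerZr ho ?mulr0// eq_sym.
Qed.

(** The representing vector is the sum of the [l (h i) *: h i]. Applying [l] to a partial sum, of
    squared norm [q n], gives [q n <= M * sqrt (q n)]; so the [q n] stay bounded and the series
    converges by completeness. *)
Lemma riesz (l : H -> R) : separable H -> scalar l -> continuous l ->
  exists k, forall x, l x = inner k x.
Proof.
move=> sepH sl cl.
have [M lM] := scalar_continuous_bounded sl cl.
(* Adapting to the empty family gives just some orthonormal basis. *)
have e0 : padded_orthonormal (fun i : 'I_0 => 0 : H) by split=> [[]|[]|[]].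
have [h [[[ho hu _] hH] _ _]] := adapted_basis sepH e0.
have hoo : orthonormal_or0 h by split.
have lh0 i : h i = 0 -> l (h i) = 0 by move=> ->; exact: scalar_fun0.
have N := @inner_sum_orthonormal h (l \o h) _ _ hoo lh0.
pose q := series (fun i => l (h i) ^+ 2).
have qM n : q n <= M ^+ 2.
  have := lM (\sum_(0 <= i < n) l (h i) *: h i).
  rewrite scalar_fun_sum//; under eq_bigr do rewrite scalar_funZ// -expr2.
  have q0 : 0 <= q n by apply: sumr_ge0 => i _; exact: sqr_ge0.
  rewrite -/(q n) ger0_norm//.
  move: (N 0%N n); rewrite -/(q n); set t := `|_| => tq.
  have -> : q n = t ^+ 2 by rewrite tq.
  have [->|t0] := eqVneq t 0; first by rewrite expr0n/= sqr_ge0.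
  have {}t0 : 0 < t by rewrite lt_def t0 normr_ge0.
  rewrite -[X in X <= _]tq expr2 ler_pM2r// => tM.
  by rewrite -expr2 lerXn2r ?nnegrE// ltW// (lt_le_trans t0).
have qc : cvgn q.
  apply: nondecreasing_is_cvgn; last by exists (M ^+ 2) => _ [n _ <-].
  by apply: nondecreasing_series => i _ _; exact: sqr_ge0.
pose s := series (fun i => l (h i) *: h i).
have sc : cvgn s.
  apply/cauchy_cvgP/cauchy_seriesP => e e0'.
  move/cauchy_cvgP/cauchy_seriesP: qc => /(_ _ (exprn_gt0 2 e0')).
  apply: filterS => -[m n] /=; rewrite -(N m n).
  by rewrite ger0_norm ?sqr_ge0// ltr_pXn2r// ?nnegrE// ltW.
exists (limn s) => x.
apply/eqP; rewrite -subr_eq0; apply/eqP.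
have lk : scalar (fun x => l x - inner (limn s) x).
  by move=> c y z; rewrite sl inner_scalar; ring.
apply: (@scalar_closure_lin_span _ _ _ (range h) x lk).
- by move=> y; apply: (@continuousB _ R^o); [exact: cl|exact: inner_continuous].
- move=> _ [j _ <-]; apply/eqP; rewrite subr_eq0 eq_sym innerC; apply/eqP.
  have /cvg_lim <- // : inner (h j) (s n) @[n --> \oo] --> l (h j).
    apply: cvg_near_cst; exists j.+1 => // n /= jn.
    rewrite inner_sumr (bigD1_seq j)/= ?mem_index_iota ?iota_uniq ?jn//.
    rewrite big1 ?addr0 => [|i ij]; last by rewrite innerZr ho ?mulr0// eq_sym.
    rewrite innerZr; have [->|/[dup]/lh0 ->] := hu j; first by rewrite mulr1.
    by rewrite mul0r.
  by apply/esym/cvg_lim => //; apply: (cvg_comp _ _ sc); exact: inner_continuous.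
- by rewrite hH.
Qed.

(** The Riesz vector of [a \o f], which is the adjoint applied to [a], is orthogonal to the common
    kernel of the conditions and hence lies in the closed span of [e]. *)
Lemma inner_adjoint_orthocompl (W : Type) (f : H -> W) (A : set (W -> R)) N
    (e : 'I_N -> H) (a : W -> R) (x : H) :
  separable H ->
  closure (lin_span (range e)) =
    orthocompl [set h | forall a, A a -> a (f h) = 0] ->
  A a -> scalar (a \o f) -> continuous (a \o f) ->
  (forall i, inner (e i) x = 0) -> a (f x) = 0.
Proof.
move=> sepH eA Aa saf caf ex.
have [k kaf] := riesz sepH saf caf.
have -> : a (f x) = inner x k by rewrite innerC -kaf.
apply: (scalar_closure_lin_span (@inner_scalar _ _ x) (@inner_continuous _ _ x)
  (V := range e)).
  by move=> _ [i _ <-]; rewrite innerC.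
by rewrite eA => y yA; rewrite -kaf/= yA.
Qed.

End riesz.

(** * Functionals on the space of continuous functions *)

Section finite_functionals.
Context {R : realType} {V : lmodType R}.

Lemma kernel_combination n (f : 'I_n -> V -> R) (g : V -> R) :
  (forall i, scalar (f i)) -> scalar g ->
  (forall x, (forall i, f i x = 0) -> g x = 0) ->
  exists c : 'I_n -> R, forall x, g x = \sum_i c i * f i x.
Proof.
elim: n f g => [|n IH] f g sf sg fg.
  by exists (fun=> 0) => x; rewrite big_ord0; apply: fg => -[].
pose f' (i : 'I_n) := f (lift ord_max i).
have f'0 x : (forall i, f' i x = 0) -> f ord_max x = 0 -> forall i, f i x = 0.
  move=> f'x fx i; case: (unliftP ord_max i) => [j ->|-> //]; exact: f'x.
have [fn0|] := pselect (forall x, (forall i, f' i x = 0) -> f ord_max x = 0).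
  have [i|//|x f'x|c gc] := IH f' g; first exact: sf.
    by apply: fg; apply: f'0 => //; exact: fn0.
  exists (fun i => if unlift ord_max i is Some j then c j else 0) => x.
  rewrite gc big_ord_recr/= unlift_none mul0r addr0; apply: eq_bigr => i _.
  rewrite (_ : widen_ord _ _ = lift ord_max i) ?liftK//.
  by apply: val_inj; rewrite /= /bump leqNgt ltn_ord.
move=> /existsNP[v /not_implyP[f'v /eqP fv]].
pose w := (f ord_max v)^-1 *: v.
have fw : f ord_max w = 1 by rewrite scalar_funZ// mulVf.
have f'w i : f' i w = 0 by have := f'v i; rewrite /f' scalar_funZ// => ->; rewrite mulr0.
pose g' x := g x - g w * f ord_max x.
have sg' : scalar g' by move=> c x y; rewrite /g' sg sf; ring.
have [i|//|x f'x|c gc] := IH f' g'; first exact: sf.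
  have : g (x - f ord_max x *: w) = 0.
    apply: fg; apply: f'0 => [i|]; rewrite scalar_funB//; last first.
      by rewrite scalar_funZ// fw mulr1 subrr.
    - exact: sf.
    - by rewrite f'x scalar_funZ; [rewrite f'w mulr0 subrr|exact: sf].
  by rewrite scalar_funB// scalar_funZ// /g' mulrC.
exists (fun i => if unlift ord_max i is Some j then c j else g w) => x.
rewrite big_ord_recr/= unlift_none.
have -> : g x = g' x + g w * f ord_max x by rewrite /g' subrK.
rewrite gc; congr (_ + _); apply: eq_bigr => i _.
rewrite (_ : widen_ord _ _ = lift ord_max i) ?liftK//.
by apply: val_inj; rewrite /= /bump leqNgt ltn_ord.
Qed.

End finite_functionals.

(** * Piecewise linear interpolation *)

Section hat_functions.
Context {R : realType}.

Definition hat (y : R) : R := Num.max 0 (1 - `|y|).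

Lemma hat_ge0 y : 0 <= hat y.
Proof. by rewrite /hat le_max lexx. Qed.

Lemma hat_gt0 y : hat y != 0 -> `|y| < 1.
Proof.
by rewrite /hat; case: (leP (1 - `|y|) 0) => [_|]; [rewrite eqxx|lra].
Qed.

(** The integer translates of [hat] form a partition of unity: their sum is 1 up to [m] and
    decreases linearly to 0 on the next unit interval. *)
Lemma sum_hat m (y : R) : 0 <= y ->
  \sum_(k < m.+1) hat (y - k%:R) = Num.min 1 (Num.max 0 (m.+1%:R - y)).
Proof.
move=> y0; elim: m => [|m IH].
  rewrite big_ord_recr big_ord0/= add0r subr0 /hat ger0_norm//.
  by case: (leP (1 - y) 0) => ?; case: (leP 1 _) => ?; lra.
rewrite big_ord_recr/= IH /hat -(@natr1 R m.+1) -(@natr1 R m).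
have [h1|h1] := leP (y - (m%:R + 1)) 0;
rewrite ?(ler0_norm h1) ?(gtr0_norm h1);
repeat (match goal with |- context [Order.max ?a ?b] => case: (leP a b) => ?
        | |- context [Order.min ?a ?b] => case: (leP a b) => ? end); lra.
Qed.

Lemma hat_continuous : continuous hat.
Proof.
move=> y; apply: (@continuous_max _ _ (cst 0) (fun y => 1 - `|y|)).
  exact: cst_continuous.
apply: (@continuousB _ R^o); first exact: cst_continuous.
exact: norm_continuous.
Qed.

End hat_functions.

Section C0_dual.
Context {R : realType} {T : R}.
Local Notation K := `[0, T]%classic.
Implicit Types (f : C0 T).

Lemma eval_dual (t : K) : C0_dual T (fun f => f t).
Proof.
have sev : scalar (fun f : C0 T => f t) by [].
split=> //; apply: (bounded_scalar_continuous (M := 1) sev) => f.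
by rewrite mul1r; exact: sup_norm_ge.
Qed.

Lemma C0_sumE I (r : seq I) (F : I -> C0 T) (t : K) :
  (\sum_(i <- r) F i) t = \sum_(i <- r) F i t.
Proof. exact: (scalar_fun_sum (eval_dual t).1). Qed.

(** Heine-Cantor. Around [x] the values stay within [e / 2] of [F x] up to radius [r]; granting
    [r / 2] to the first point and [r / 2] to the distance leaves a local statement that compactness
    makes uniform. *)
Lemma C0_unif_continuous f (e : R) : 0 < e -> exists2 d : R, 0 < d &
  forall x y : K, `|set_val x - set_val y| < d -> `|f x - f y| <= e.
Proof.
move=> e0; pose F : R -> R := valL (f : K -> R).
have Ff (x : K) : F (set_val x) = f x.
  by have /(congr1 (@^~ x)) := valLK point (f : K -> R).
have cF : {within K, continuous F}.
  by have /subspace_valL_continuousP := @C0_cts _ _ f.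
move/subspace_continuousP : cF => cF.
have /compact_near_coveringP/(_ R 0^'+ (fun d x => K x -> forall y, K y ->
    `|x - y| < d -> `|F x - F y| <= e)) := @segment_compact R 0 T.
case=> [x Kx|d/= d0 dP]; last first.
  exists (d / 2); first by rewrite divr_gt0.
  move=> x y xy; rewrite -!Ff; apply: (dP (d / 2)) xy; rewrite /ball/=.
  - by rewrite sub0r normrN gtr0_norm ?divr_gt0// ltr_pdivrMr// ltr_pMr// ltr1n.
  - by rewrite divr_gt0.
  - exact: (set_valP x).
  - exact: (set_valP x).
  - exact: (set_valP y).
have /cvgrPdist_lt/(_ _ (divr_gt0 e0 (ltr0Sn R 1)))/nbhs_ballP[r/= r0 rP] := cF x Kx.
exists (ball x (r / 2), [set d | d < r / 2]) => /=.
  split; first by apply: nbhsx_ballx; rewrite divr_gt0.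
  by apply: nbhs_right_lt; rewrite divr_gt0.
move=> [z d]/= [xz dr] Kz y Ky zy.
have xz' : ball x r z.
  by apply: le_ball xz; rewrite ler_pdivrMr// ler_pMr// ler1n.
have xy : ball x r y.
  rewrite (splitr r); apply: ball_triangle xz _.
  exact: lt_trans zy dr.
have h1 := rP _ xz' Kz; have h2 := rP _ xy Ky.
rewrite (_ : F z - F y = (F x - F y) - (F x - F z)); last by ring.
by rewrite (le_trans (ler_normB _ _))// (splitr e) lerD// ltW.
Qed.

Hypothesis T0 : 0 < T.

Lemma clamp_subproof (r : R) : Num.min T (Num.max 0 r) \in K.
Proof.
rewrite inE/= in_itv/= le_min ge_min lexx le_max lexx/= !andbT//; exact: ltW.
Qed.

(** Interpolation nodes are real numbers; clamping turns them into points of the subtype. *)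
Definition clamp r : K := exist (fun x => x \in K) _ (clamp_subproof r).

Lemma clampK r : 0 <= r <= T -> set_val (clamp r) = r.
Proof. by move=> /andP[r0 rT]; rewrite set_valE/= max_r ?min_r. Qed.

(** The tent centred at the node [k * T / n.+1] of the subdivision of [[0, T]] into [n.+1] equal
    pieces. *)
Definition hatC_fun n k (x : K) := hat (set_val x * n.+1%:R / T - k%:R).

Lemma hatC_subproof n k : hatC_fun n k \in @cont_on R T.
Proof.
apply/mem_set => /= x.
apply: (@continuous_comp _ _ _ (fun y : K => set_val y * n.+1%:R / T - k%:R) hat);
  last exact: hat_continuous.
apply: (@continuousB _ R^o); last exact: cst_continuous.
apply: continuousM; last exact: cst_continuous.
apply: continuousM; last exact: cst_continuous.
exact: initial_continuous.
Qed.

Definition hatC n k : C0 T := MkC0 (hatC_subproof n k).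

(** The piecewise linear interpolants of [f] converge uniformly, and [a] is continuous. Every
    functional is thus a limit of combinations of evaluations and inherits measurability from
    them. *)
Lemma dual_interpolation (a : C0 T -> R) f : C0_dual T a ->
  \sum_(k < n.+2) a (hatC n k) * f (clamp (k%:R * T / n.+1%:R)) @[n --> \oo]
    --> a f.
Proof.
move=> [sa ca].
pose fn n := \sum_(k < n.+2) f (clamp (k%:R * T / n.+1%:R)) *: hatC n k.
rewrite [X in X @ _ --> _](_ : _ = a \o fn); last first.
  apply/funext => n /=; rewrite scalar_fun_sum//; apply: eq_bigr => k _.
  by rewrite (scalar_funZ sa) mulrC.
apply: continuous_cvg; first exact: ca.
apply/cvgrPdist_le => e e0.
have [d d0 dP] := C0_unif_continuous f e0.
near=> n; apply: sup_norm_le; first exact: ltW.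
move=> x; have /andP[x0 xT] : 0 <= set_val x <= T.
  by have := set_valP x; rewrite /= in_itv.
have n0 : 0 < n.+1%:R :> R by [].
set y := set_val x * n.+1%:R / T.
have y0 : 0 <= y by rewrite /y divr_ge0 ?mulr_ge0// ltW.
have yn : y <= n.+1%:R by rewrite /y ler_pdivrMr// mulrC ler_wpM2l.
(* [y] lies in [[0, n + 1]], where the [n.+2] translates add up to 1. *)
have sum1 : \sum_(k < n.+2) hat (y - k%:R) = 1.
  rewrite sum_hat// -natr1 max_r; last by lra.
  by rewrite min_l//; lra.
have -> : (f - fn n) x = \sum_(k < n.+2)
    (f x - f (clamp (k%:R * T / n.+1%:R))) * hat (y - k%:R).
  transitivity (f x - (fn n) x) => //.
  rewrite -[f x]mulr1 -{1}sum1 mulr_sumr /fn C0_sumE -sumrB.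
  by apply: eq_bigr => k _; rewrite mulrBl; congr (_ - _); rewrite mulr1.
rewrite (le_trans (ler_norm_sum _ _ _))//.
rewrite -[leRHS]mulr1 -[X in _ <= e * X]sum1 mulr_sumr ler_sum// => k _.
rewrite normrM (ger0_norm (hat_ge0 _)).
(* Only nodes at less than one mesh width from the point contribute. *)
have [->|/hat_gt0 hk] := eqVneq (hat (y - k%:R)) 0; first by rewrite !mulr0.
rewrite ler_wpM2r ?hat_ge0// dP//=.
have kn : k%:R <= n.+1%:R :> R by rewrite ler_nat -ltnS.
rewrite clampK; last first.
  rewrite divr_ge0 ?mulr_ge0// ?(ltW T0)//=.
  by rewrite ler_pdivrMr// mulrC ler_pM2l.
rewrite (_ : _ - _ = (y - k%:R) * (T / n.+1%:R)); last first.
  rewrite /y; move: (n.+1%:R : R) n0 => m m0; field.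
  by rewrite !lt0r_neq0.
rewrite normrM (@le_lt_trans _ _ (T / n.+1%:R))//.
  rewrite (@ger0_norm _ (T / _)) ?divr_ge0// ?(ltW T0)//.
  by rewrite ler_piMl// ?ltW// divr_gt0.
rewrite ltr_pdivrMr// -ltr_pdivrMl//.
rewrite (@lt_trans _ _ n%:R) ?ltr_nat//.
near: n; exact: nbhs_infty_gtr.
Unshelve. all: by end_near. Qed.

Lemma dual_measurable d (Omega : measurableType d) (X : Omega -> C0 T) (a : C0 T -> R) :
  (forall t, measurable_fun [set: Omega] (fun w => X w t)) -> C0_dual T a ->
  measurable_fun [set: Omega] (a \o X).
Proof.
move=> mX Da; apply: (measurable_fun_cvg (h := fun n w =>
    \sum_(k < n.+2) a (hatC n k) * X w (clamp (k%:R * T / n.+1%:R)))).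
  by move=> n; apply: measurable_sum => k; exact: measurable_funM.
by move=> w _; exact: dual_interpolation.
Qed.

End C0_dual.

(** * Independent standard normal variables *)

Section image_measure.
Context {d d'} {T : measurableType d} {T' : measurableType d'} {R : realType}.

Definition image_measure (m : {measure set T -> \bar R}) (f : T -> T')
    (mf : measurable_fun [set: T] f) : {measure set T' -> \bar R} :=
  measure_function_pushforward__canonical__measure_function_Measure m mf.

(** Both sides are finite measures in [A] that agree on a pi-system containing the whole space. *)
Lemma pi_system_independence (P : probability T R) (mu : probability T' R)
    (f : T -> T') (E : set T) (G : set (set T')) :
  measurable_fun [set: T] f -> measurable E ->
  measurable = <<s G >> -> setI_closed G -> G setT ->
  (forall A, G A -> P (f @^-1` A `&` E) = (mu A * P E)%E) ->
  forall A, measurable A -> P (f @^-1` A `&` E) = (mu A * P E)%E.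
Proof.
move=> mf mE mG GI GT PG A mA.
have PE : (fine (P E))%:E = P E by rewrite fineK ?fin_num_measure.
pose m1 := image_measure (mrestr P mE) mf.
have e0 : 0 <= fine (P E) by rewrite fine_ge0.
pose m2 : {measure set T' -> \bar R} := mscale (NngNum e0) mu.
have : m1 A = m2 A.
  apply: (measure_unique G (fun=> setT)) => //; first by rewrite bigcup_const.
    by move=> B GB; rewrite /m2 /= /mscale/= PE muleC -PG.
  move=> _; rewrite /m1 /= /pushforward/= /mrestr preimage_setT setTI.
  by rewrite -PE ltry.
by rewrite /m1 /m2/= /mscale/= PE muleC.
Qed.

End image_measure.

(** * Binary digits of a uniform variable *)

Section uniform_bits.
Context {R : realType}.
Local Notation lambda := (@lebesgue_measure R).
Local Notation U := (uniform_prob (@ltr01 R)).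

Lemma uniform01E (A : set R) : measurable A -> U A = lambda (A `&` `[0, 1]).
Proof.
move=> mA; rewrite /uniform_prob integral_uniform_pdf.
rewrite (eq_integral (cst 1%E)) ?integral_cst ?mul1e//; first exact: measurableI.
move=> x; rewrite inE => -[_ /=]; rewrite in_itv/= => x01.
by rewrite /uniform_pdf x01 subr0 invr1.
Qed.

Lemma measurable_affine (b c : R) : measurable_fun [set: R] (fun x => b * x - c).
Proof. by apply: measurable_funB => //; exact: measurable_funM. Qed.

(** Uniqueness of Lebesgue measure: twice the image measure gives each half-open interval its
    length. *)
Lemma lebesgue_double (c : R) (A : set R) : measurable A ->
  lambda ((fun x => 2 * x - c) @^-1` A) = ((2^-1)%:E * lambda A)%E.
Proof.
move=> mA; pose f (x : measurableTypeR R) : measurableTypeR R := 2 * x - c.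
have mf : measurable_fun [set: measurableTypeR R] f by exact: measurable_affine.
pose m : {measure set (measurableTypeR R) -> \bar R} :=
  mscale (NngNum (@ler0n R 2)) (image_measure lambda mf).
have : lambda A = m A.
  apply: lebesgue_measure_unique => // _ [[a b] _ <-].
  rewrite /m/= /mscale/= /pushforward/=.
  rewrite (_ : f @^-1` _ = `](a + c) / 2, (b + c) / 2]%classic); last first.
    apply/seteqP; split=> x /=; rewrite !in_itv/= /f => /andP[? ?].
      by apply/andP; split; lra.
    by apply/andP; split; lra.
  rewrite !lebesgue_measure_itv/= !lte_fin.
  have -> : ((a + c) / 2 < (b + c) / 2) = (a < b) by apply/idP/idP; lra.
  case: ifPn => _; last by rewrite mule0.
  by rewrite -!EFinB -EFinM; congr EFin; field.
rewrite /m/= /mscale/= /pushforward/= => ->.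
by rewrite muleA -EFinM mulVf ?mul1e.
Qed.

Definition bit0 (x : R) : bool := 2^-1 <= x.

(** The digit shift. The point 1 is fixed, with all digits 1, so [[0, 1]] is preserved. *)
Definition doubling (x : R) : R := 2 * x - (bit0 x)%:R.

Definition binary_digits (x : R) (i : nat) : bool := bit0 (iter i doubling x).

Lemma measurable_bit0 : measurable_fun [set: R] bit0.
Proof. by apply: measurable_fun_ler. Qed.

Lemma measurable_doubling : measurable_fun [set: R] doubling.
Proof.
apply: measurable_funB; first exact: measurable_funM.
rewrite (_ : (fun x => _) = fun x : R => if bit0 x then 1 else 0).
  by apply: measurable_fun_ifT => //; exact: measurable_bit0.
by apply/funext => x; case: bit0.
Qed.

Lemma measurable_preimage d d' (T : measurableType d) (T' : measurableType d')
  (f : T -> T') (A : set T') :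
  measurable_fun [set: T] f -> measurable A -> measurable (f @^-1` A).
Proof. by move=> mf mA; rewrite -[X in measurable X]setTI; exact: mf. Qed.

Lemma measurable_bit0_eq b : measurable [set x : R | bit0 x = b].
Proof. exact: (measurable_preimage measurable_bit0 (A := [set b])). Qed.

(** On each half of the unit interval [doubling] is affine with slope 2. Hence the first digit is
    fair and independent of the shifted number, which is again uniform. *)
Lemma uniform_bit0_doubling (b : bool) (E : set R) : measurable E ->
  U ([set x | bit0 x = b] `&` doubling @^-1` E) = ((2^-1)%:E * U E)%E.
Proof.
move=> mE; rewrite !uniform01E//; last first.
  apply: measurableI; first exact: measurable_bit0_eq.
  exact: measurable_preimage measurable_doubling mE.
case: b.
  rewrite -(@lebesgue_double 1); last exact: measurableI.
  congr (lambda _).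
  apply/seteqP; split=> x /=; rewrite !in_itv/= /doubling /bit0.
    move=> [[x2]]; rewrite x2/= => Ex /andP[x0 x1].
    by split=> //; apply/andP; split; lra.
  move=> [Ex /andP[h0 h1]]; have -> : 2^-1 <= x by lra.
  by split=> //; apply/andP; split; lra.
(* The left half is mapped onto [[0, 1[]; the missing endpoint is a null set. *)
transitivity ((2^-1)%:E * lambda (E `&` `[0%R, 1%R[))%E.
  rewrite -(@lebesgue_double 0); last exact: measurableI.
  congr (lambda _).
  apply/seteqP; split=> x /=; rewrite !in_itv/= /doubling /bit0.
    move=> [[x2]]; rewrite x2/= => Ex /andP[x0 x1].
    by split=> //; apply/andP; split; lra.
  move=> [Ex /andP[h0 h1]]; have -> : 2^-1 <= x = false by lra.
  by split=> //; apply/andP; split; lra.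
congr (_ * _)%E.
have -> : `[0%R, 1%R]%classic = `[0%R, 1%R[%classic `|` [set 1%R] :> set R.
  by rewrite (@setUitv1 _ _ (BLeft 0%R) 1 true)//= bnd_simp.
rewrite setIUr measureU//=.
- rewrite [X in (_ + X)%E](_ : _ = 0%E) ?adde0//.
  apply/eqP; rewrite eq_le measure_ge0 andbT.
  rewrite -[leRHS](lebesgue_measure_set1 (1 : R)).
  by apply: le_measure; rewrite ?inE//; exact: measurableI.
- exact: measurableI.
- exact: measurableI.
- by apply/seteqP; split=> // x /= [[_ /[swap]-[_ ->]]]; rewrite in_itv/= ltxx andbF.
Qed.

Lemma binary_expansion n (x : R) :
  x = \sum_(i < n) (binary_digits x i)%:R * 2^-1 ^+ i.+1
      + 2^-1 ^+ n * iter n doubling x.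
Proof.
elim: n => [|n IH]; first by rewrite big_ord0 add0r expr0 mul1r.
rewrite big_ord_recr/= /binary_digits {1}IH -addrA; congr (_ + _).
by rewrite /doubling exprS; field.
Qed.

Lemma iter_doubling_itv n (x : R) : 0 <= x <= 1 -> 0 <= iter n doubling x <= 1.
Proof.
move=> x01; elim: n => //= n; set y := iter n _ _ => /andP[y0 y1].
by rewrite /doubling /bit0; case: (leP 2^-1 y) => /= ?; apply/andP; split; lra.
Qed.

End uniform_bits.

(** * Fair coin tosses *)

Definition cylinder (n : nat) (p : pred nat) : set (nat -> bool) :=
  [set x | forall i, (i < n)%N -> p i -> x i].

(** Only the value [true] is ever prescribed, so constraints never conflict and intersections are
    again cylinders. *)
Definition cylinders : set (set (nat -> bool)) :=
  [set A | exists n p, A = cylinder n p].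

Notation coins := (g_sigma_algebraType cylinders).

Section coins.
Context {R : realType}.
Local Notation U := (uniform_prob (@ltr01 R)).

Lemma cylinder_widen n m p : (n <= m)%N ->
  cylinder n p = cylinder m (fun i => p i && (i < n)%N).
Proof.
move=> nm; apply/seteqP; split=> x xp i.
  by move=> _ /andP[pi ni]; exact: xp.
by move=> ni pi; apply: xp; [exact: leq_trans nm|rewrite pi].
Qed.

Lemma cylinders_setI : setI_closed cylinders.
Proof.
move=> _ _ [n [p ->]] [m [q ->]].
rewrite (cylinder_widen p (leq_maxl n m)) (cylinder_widen q (leq_maxr n m)).
exists (maxn n m), (fun i => (p i && (i < n)%N) || (q i && (i < m)%N)).
apply/seteqP; split=> x.
  by move=> [xp xq] i im /orP[]; [exact: xp|exact: xq].
by move=> xpq; split=> i im h; apply: xpq; rewrite ?h ?orbT.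
Qed.

Lemma cylinder0 p : cylinder 0 p = setT.
Proof. by apply/seteqP; split. Qed.

Lemma cylinders_setT : cylinders setT.
Proof. by exists 0%N, xpred0; rewrite cylinder0. Qed.

Lemma measurable_cylinder n p : measurable (cylinder n p : set coins).
Proof. by apply: sub_sigma_algebra; exists n, p. Qed.

Lemma measurable_coin i : measurable_fun [set: coins] (fun x : coins => x i).
Proof.
apply: (@measurable_fun_bool _ _ setT _ true); rewrite setTI.
rewrite (_ : _ @^-1` _ = cylinder i.+1 (pred1 i)); first exact: measurable_cylinder.
apply/seteqP; split=> x /=; first by move=> xi j _ /eqP ->.
by move=> /(_ i (ltnSn i) (eqxx i)).
Qed.

Lemma measurable_to_coins d (T : measurableType d) (f : T -> coins) :
  (forall i, measurable_fun [set: T] (fun w => f w i)) -> measurable_fun [set: T] f.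
Proof.
move=> mf; apply: (@measurability _ _ T coins setT f cylinders) => //.
move=> _ [_ [n [p ->]] <-]; rewrite setTI.
rewrite (_ : _ @^-1` _ =
    \bigcap_(i in [set i | (i < n)%N && p i]) (f^~ i @^-1` [set true])).
  by apply: bigcap_measurableType => i _; exact: measurable_preimage.
apply/seteqP; split=> w /=; first by move=> fw i /andP[]; exact: fw.
by move=> fw i ni pi; apply: fw; rewrite /= ni.
Qed.

Definition coin_digits (x : measurableTypeR R) : coins := binary_digits x.

Lemma measurable_binary_digits : measurable_fun [set: measurableTypeR R] coin_digits.
Proof.
apply: measurable_to_coins => i.
rewrite (_ : (fun w => _) = bit0 \o iter i doubling)//.
apply: measurableT_comp; first exact: measurable_bit0.
elim: i => [|i IH]; first exact: measurable_id.
rewrite (_ : iter i.+1 doubling = doubling \o iter i doubling)//.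
by apply: measurableT_comp => //; exact: measurable_doubling.
Qed.

HB.instance Definition _ :=
  isMeasurableFun.Build _ _ _ _ coin_digits measurable_binary_digits.

Definition coin_tossing : set coins -> \bar R := distribution U coin_digits.

HB.instance Definition _ := Probability.on coin_tossing.

(** Induction on [n]: the first digit is split off, and the shifted number has the law of the
    original. *)
Lemma coin_tossing_cylinder n p :
  coin_tossing (cylinder n p) = (\prod_(i < n) (if p i then 2^-1 else 1))%:E.
Proof.
rewrite /coin_tossing /distribution /pushforward.
elim: n p => [|n IH] p.
  by rewrite cylinder0 preimage_setT big_ord0 probability_setT.
pose p' i := p i.+1; pose E := coin_digits @^-1` cylinder n p'.
have mE : measurable E.
  by apply: measurable_preimage;
    [exact: measurable_binary_digits|exact: measurable_cylinder].
pose D b := [set x : R | bit0 x = b] `&` doubling @^-1` E.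
have mD b : measurable (D b).
  apply: measurableI; first exact: measurable_bit0_eq.
  exact: measurable_preimage measurable_doubling mE.
have EP x : coin_digits x \in cylinder n.+1 p <-> (p 0%N -> bit0 x) /\ E (doubling x).
  rewrite inE; split.
    move=> h; split=> [p0|i ni pi]; first exact: (h 0%N).
    by rewrite /coin_digits /binary_digits -iterSr; exact: (h i.+1).
  move=> [h0 hE] [_|i ni pi]; first exact: h0.
  by rewrite /coin_digits /binary_digits iterSr; exact: hE.
rewrite big_ord_recl/=; under eq_bigr do rewrite /bump/= add1n.
have UD b := uniform_bit0_doubling b mE.
rewrite EFinM -(IH p'); case: ifPn => p0.
  rewrite -(UD true); congr (U _); apply/seteqP; split=> x /=.
    by move=> /mem_set/EP [/(_ p0)].
  by move=> [h hE]; apply/set_mem/EP; split=> // _; rewrite h.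
(* The first digit is unconstrained, so the two halves add up. *)
rewrite (_ : _ @^-1` _ = D true `|` D false).
  have -> : U (D true `|` D false) = (U (D true) + U (D false))%E.
    apply: measureU; [exact: mD|exact: mD|].
    by apply/seteqP; split=> // x [[/= b1 _] [/= b0 _]]; rewrite b1 in b0.
  transitivity ((2^-1)%:E * U E + (2^-1)%:E * U E)%E.
    exact: (congr2 adde (UD true) (UD false)).
  by rewrite -ge0_muleDl ?lee_fin// -EFinD (_ : _ + _ = 1)//; field.
apply/seteqP; split=> x /=.
  by move=> /mem_set/EP [_ hE]; rewrite /D/=; case: bit0; [left|right].
by move=> h; apply/set_mem/EP; rewrite (negbTE p0); split=> //; case: h => -[].
Qed.

Definition evens (x : coins) : coins := fun i => x i.*2.
Definition odds (x : coins) : coins := fun i => x i.*2.+1.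

Lemma measurable_evens : measurable_fun [set: coins] evens.
Proof. by apply: measurable_to_coins => i; exact: measurable_coin. Qed.

Lemma measurable_odds : measurable_fun [set: coins] odds.
Proof. by apply: measurable_to_coins => i; exact: measurable_coin. Qed.

Lemma evens_odds_cylinder n p q :
  coin_tossing (evens @^-1` cylinder n p `&` odds @^-1` cylinder n q) =
  (coin_tossing (cylinder n p) * coin_tossing (cylinder n q))%E.
Proof.
(* [r] interleaves [p] and [q], turning both constraints into one on the first [2n] tosses. *)
pose r i := if odd i then q i./2 else p i./2.
rewrite (_ : _ `&` _ = cylinder n.*2 r).
  rewrite !coin_tossing_cylinder -EFinM; congr EFin.
  elim: n => [|n IH]; first by rewrite !big_ord0 mulr1.
  rewrite doubleS !big_ord_recr/= IH /r/= odd_double/= uphalf_double doubleK.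
  by ring.
apply/seteqP; split=> x.
  move=> [xp xq] i i2 ri; rewrite -(odd_double_half i).
  have i2n : (i./2 < n)%N by rewrite ltn_half_double.
  by move: ri; rewrite /r; case: odd => ri; rewrite ?add1n ?add0n; [exact: xq|exact: xp].
move=> xr; split=> i ni h; apply: xr.
- by rewrite ltn_double.
- by rewrite /r odd_double doubleK.
- by rewrite -doubleS leq_double.
- by rewrite /r/= odd_double/= uphalf_double.
Qed.

(** The product formula extends from cylinders to measurable sets one factor at a time, by the
    pi-system argument. *)
Lemma evens_odds_independent (A B : set coins) : measurable A -> measurable B ->
  coin_tossing (evens @^-1` A `&` odds @^-1` B) =
  (coin_tossing A * coin_tossing B)%E.
Proof.
move=> mA mB.
have C n p m q : coin_tossing (evens @^-1` cylinder n p `&` odds @^-1` cylinder m q) =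
  (coin_tossing (cylinder n p) * coin_tossing (cylinder m q))%E.
  rewrite (cylinder_widen p (leq_maxl n m)) (cylinder_widen q (leq_maxr n m)).
  exact: evens_odds_cylinder.
have odds_law q m : coin_tossing (odds @^-1` cylinder m q) = coin_tossing (cylinder m q).
  have := C 0%N xpred0 m q.
  by rewrite cylinder0 preimage_setT setTI probability_setT mul1e.
have step1 D : measurable D -> forall m q,
    coin_tossing (evens @^-1` D `&` odds @^-1` cylinder m q) =
    (coin_tossing D * coin_tossing (cylinder m q))%E.
  move=> mD m q; rewrite -odds_law.
  apply: (@pi_system_independence _ _ _ _ R coin_tossing coin_tossing evens _
    cylinders) => //.
  - exact: measurable_evens.
  - by apply: measurable_preimage; [exact: measurable_odds|exact: measurable_cylinder].
  - exact: cylinders_setI.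
  - exact: cylinders_setT.
  - move=> _ [n [p ->]]; apply: etrans (C n p m q) _.
    by congr (_ * _)%E; exact/esym/odds_law.
have evens_law : coin_tossing (evens @^-1` A) = coin_tossing A.
  have := step1 A mA 0%N xpred0.
  by rewrite cylinder0 preimage_setT setIT probability_setT mule1.
rewrite setIC muleC -evens_law.
apply: (@pi_system_independence _ _ _ _ R coin_tossing coin_tossing odds _
  cylinders) => //.
- exact: measurable_odds.
- exact: measurable_preimage measurable_evens mA.
- exact: cylinders_setI.
- exact: cylinders_setT.
- move=> _ [n [p ->]]; rewrite setIC muleC; apply: etrans (step1 A mA n p) _.
  by congr (_ * _)%E; exact/esym/evens_law.
Qed.

End coins.

(** * Independent normal variables from coin tosses *)

Section normal_sequence.
Context {R : realType}.
Local Notation lambda := (@lebesgue_measure R).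
Local Notation U := (uniform_prob (@ltr01 R)).

Lemma uniform01oE (A : set R) : measurable A -> U A = lambda (A `&` `]0, 1[).
Proof.
move=> mA; rewrite uniform01E//.
have -> : A `&` `[0, 1] = (A `&` `]0, 1[) `|` (A `&` ([set 0] `|` [set 1])).
  rewrite -setIUr; congr (_ `&` _); apply/seteqP; split=> x /=; rewrite !in_itv/=.
    move=> /andP[x0 x1]; have [->|n0] := eqVneq x 0; first by right; left.
    have [->|n1] := eqVneq x 1; first by right; right.
    by left; rewrite !lt_neqAle eq_sym n0 x0 n1 x1.
  by case=> [/andP[/ltW-> /ltW->]//|[->|->]]; rewrite lexx ?ler01.
have m2 : measurable ([set 0] `|` [set 1] : set R) by exact: measurableU.
apply: measureU0; [exact: measurableI|exact: measurableI|].
apply/eqP; rewrite eq_le measure_ge0 andbT.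
have l1 z : lambda [set z] = 0%E by exact: lebesgue_measure_set1.
have <- : lambda ([set 0] `|` [set 1]) = 0%E.
  by apply: etrans (l1 0); apply: measureU0 => //; exact: l1.
by apply: le_measure; rewrite ?inE//; exact: measurableI.
Qed.

(** [q] is the quantile function: right-continuity of the distribution function [F] gives [q u <= x]
    iff [u <= F x] on []0, 1[]. So a ray []x, +oo[] pulls back there to []F x, 1[], whose length is
    the mass of the ray. *)
Lemma inverse_transform_sampling (nu : probability (measurableTypeR R) R) :
  exists2 q : R -> R, measurable_fun [set: R] q &
    forall A, measurable A -> U (q @^-1` A) = nu A.
Proof.
pose X : {mfun (measurableTypeR R) >-> R} :=
  HB.pack (idfun : measurableTypeR R -> R)
   (isMeasurableFun.Build _ _ (measurableTypeR R) R idfun (@measurable_id _ R setT)).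
pose F x := fine (cdf (X : {RV nu >-> R}) x).
have FE x : (F x)%:E = nu `]-oo, x]%classic by rewrite /F fineK ?fin_num_measure.
have Fnd : {homo F : x y / x <= y}.
  by move=> x y xy; rewrite fine_le ?fin_num_measure// cdf_nondecreasing.
have Frc x : F z @[z --> x^'+] --> F x.
  by apply: fine_cvg; rewrite fineK ?fin_num_measure//; exact: cdf_right_continuous.
have F0 x : 0 <= F x by rewrite fine_ge0.
have F1 x : F x <= 1 by rewrite -lee_fin FE; exact: probability_le1.
have Fy : F x @[x --> +oo] --> (1 : R) by exact/fine_cvg/cvg_cdfy1.
have FNy : F x @[x --> -oo] --> (0 : R) by exact/fine_cvg/cvg_cdfNy0.
pose S u := [set x | u <= F x].
have Sinf u : 0 < u < 1 -> has_inf (S u).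
  move=> /andP[u0 u1]; split.
    have /filter_ex[x /ltW Fx] : \forall x \near +oo, u < F x by exact: (cvgr_gt 1).
    by exists x.
  have : \forall x \near -oo, F x < u by exact: (cvgr_lt 0).
  case=> M [_ MF]; exists M => x; rewrite /S/= => uF; rewrite leNgt; apply/negP => /MF.
  by rewrite ltNge uF.
(* Outside []0, 1[], which has probability zero, [S u] may be empty or unbounded below; 0 is a
   default value. *)
pose q u := if 0 < u < 1 then inf (S u) else 0.
have qP u x : 0 < u < 1 -> (q u <= x) = (u <= F x).
  move=> u01; rewrite /q u01; apply/idP/idP => [ux|uF]; last first.
    by apply: ge_inf => //; exact: (Sinf _ u01).2.
  rewrite leNgt; apply/negP => Fu.
  (* Right-continuity yields a point beyond [x] where [F] is still below [u], against [q u <= x]. *)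
  have [z [xz Fz]] : exists z, x < z /\ F z < u.
    have : \forall z \near x^'+, F z < u by exact: (cvgr_lt (F x)).
    move=> H; have /filter_ex[z [? ?]] : \forall z \near x^'+, x < z /\ F z < u.
      by near=> z; split; near: z; [exact: nbhs_right_gt|].
    by exists z.
  have [y Sy yz] := inf_lt (Sinf _ u01).1 (le_lt_trans ux xz).
  have := le_lt_trans (le_trans Sy (Fnd _ _ (ltW yz))) Fz.
  by rewrite ltxx.
have qpre x : q @^-1` `]x, +oo[ = (`]0, 1[ `&` `]F x, +oo[) `|`
    (~` `]0, 1[ `&` (if x < 0 then setT else set0)).
  apply/seteqP; split=> u /=.
    rewrite !in_itv/= !andbT; have [u01|nu01] := boolP (0 < u < 1).
      by rewrite ltNge qP// -ltNge => ?; left.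
    by rewrite /q (negbTE nu01) => ->; right; split=> //; exact/negP.
  rewrite !in_itv/= !andbT => -[[u01 Fu]|[/negP nu01]].
    by rewrite ltNge qP// -ltNge.
  by rewrite /q (negbTE nu01); case: ifP.
have mq : measurable_fun [set: R] q.
  apply: (measurability _ (RGenOInfty.measurableE R)) => _ [_ [x ->] <-].
  rewrite setTI qpre; apply: measurableU; apply: measurableI => //.
    exact: measurableC.
  by case: ifP.
exists q => // A mA.
have mq' : measurable_fun [set: measurableTypeR R] (q : _ -> measurableTypeR R) by [].
have : image_measure U mq' A = nu A; last by [].
apply: (@measure_unique _ R (measurableTypeR R) (@RGenOInfty.G R)
  (fun k => `]- k%:R, +oo[%classic) _ _ _ _ (image_measure U mq') nu) => //.
- exact: RGenOInfty.measurableE.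
- move=> _ _ [x ->] [y ->]; exists (Num.max x y); apply/seteqP; split=> z /=;
    rewrite !in_itv/= !andbT gt_max; first by move=> [-> ->].
  by move=> /andP.
- by move=> k; exists (- k%:R).
- rewrite -subTset => x _; exists (Num.truncn `|x|).+1 => //=.
  rewrite in_itv/= andbT ltrNl (le_lt_trans (ler_norm _))// normrN.
  exact: Num.Theory.truncnS_gt.
- move=> _ [x ->]; apply: (etrans (uniform01oE _)).
    by rewrite -[X in measurable X]setTI; exact: mq.
  rewrite (_ : _ `&` _ = `]F x, 1[%classic); last first.
    rewrite qpre; apply/seteqP; split=> u /=; rewrite !in_itv/= !andbT.
      by move=> [[[_ ->]/andP[]//|[]]].
    by move=> /andP[Fu u1]; rewrite (le_lt_trans (F0 x) Fu) u1 Fu; split=> //; left.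
  have nuE : nu `]x, +oo[%classic = (1 - (F x)%:E)%E.
    rewrite FE -probability_setC//; congr (nu _).
    by rewrite setCitvl.
  apply: etrans (esym nuE).
  rewrite lebesgue_measure_itv/= lte_fin.
  case: ltP => // F1'; have -> : F x = 1 by apply/eqP; rewrite eq_le F1' F1.
  by rewrite subee.
- move=> k; apply: le_lt_trans (ltry 1); apply: (@probability_le1 _ _ _ U).
  by rewrite -[X in measurable X]setTI; exact: mq'.
Unshelve. all: by end_near. Qed.

Definition coin_sum n (y : coins) : R := \sum_(i < n) (y i)%:R * 2^-1 ^+ i.+1.

Definition coin_value (y : coins) : R := limn (coin_sum ^~ y).

Lemma cvg_coin_sum y : cvgn (coin_sum ^~ y).
Proof.
apply: nondecreasing_is_cvgn.
  apply/nondecreasing_seqP => n; rewrite /coin_sum big_ord_recr/= lerDl.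
  by rewrite mulr_ge0// exprn_ge0.
exists 1 => _ [n _ <-].
(* The geometric sum is the strengthening of the bound 1 that passes through the induction. *)
apply: (@le_trans _ _ (1 - 2^-1 ^+ n)); last by rewrite gerBl exprn_ge0.
elim: n => [|n IH]; first by rewrite /coin_sum big_ord0 expr0 subrr.
rewrite /coin_sum big_ord_recr/=; apply: le_trans (lerD IH (lexx _)) _.
have e0 : 0 <= 2^-1 ^+ n :> R by rewrite exprn_ge0.
by rewrite exprS; case: (y n) => /=; lra.
Qed.

Lemma measurable_coin_value : measurable_fun [set: coins] coin_value.
Proof.
apply: (@measurable_fun_cvg _ _ _ _ (fun n y => coin_sum n y)); last first.
  by move=> y _; exact: cvg_coin_sum.
move=> n; apply: measurable_sum => i; apply: measurable_funM => //.
rewrite (_ : (fun y : coins => _) = fun y : coins => if y i then 1 else 0).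
  by apply: measurable_fun_ifT => //; exact: measurable_coin.
by apply/funext => y; case: (y i).
Qed.

(** The remainder after [n] digits is [2^-n] times a number in [[0, 1]]. *)
Lemma coin_digitsK (x : R) : 0 <= x <= 1 -> coin_value (coin_digits x) = x.
Proof.
move=> x01; apply/cvg_lim => //.
apply/cvgrPdist_le => e e0; near=> n.
rewrite {1}(binary_expansion n x) addrAC subrr add0r.
have /andP[y0 y1] := iter_doubling_itv n x01.
have p0 : 0 <= 2^-1 ^+ n :> R by rewrite exprn_ge0.
rewrite ger0_norm ?mulr_ge0//; apply: (@le_trans _ _ (2^-1 ^+ n)).
  by rewrite ler_piMr.
rewrite -[leLHS]ger0_norm//; near: n; apply: cvgr0_norm_le => //.
by apply: cvg_expr; rewrite ger0_norm// invf_lt1// ltr1n.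
Unshelve. all: by end_near.
Qed.

(** Summing the digits gives back the uniform variable, to which the quantile function of [nu] is
    applied. *)
Lemma coin_tossing_law (nu : probability (measurableTypeR R) R) :
  exists2 phi : coins -> R, measurable_fun [set: coins] phi &
    forall A, measurable A -> @coin_tossing R (phi @^-1` A) = nu A.
Proof.
have [q mq qnu] := inverse_transform_sampling nu.
have mphi : measurable_fun [set: coins] (q \o coin_value).
  by apply: measurableT_comp => //; exact: measurable_coin_value.
exists (q \o coin_value) => // A mA.
rewrite -(qnu A mA) /coin_tossing /distribution /pushforward.
apply: (etrans (uniform01E _)); last first.
apply: (etrans _ (esym (uniform01E _))).
- congr (lebesgue_measure _); apply/seteqP; split=> x /=.
    by move=> [+ x01]; rewrite coin_digitsK.
  by move=> [qx x01]; split=> //; rewrite coin_digitsK.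
- exact: measurable_preimage.
- apply: (measurable_preimage (f := coin_digits)); first exact: measurable_binary_digits.
  exact: (measurable_preimage mphi mA).
Qed.

Lemma exists_independent_standard_normal :
  exists om : nat -> coins -> R, independent_standard_normal (@coin_tossing R) om.
Proof.
have [phi mphi phiN] := coin_tossing_law (normal_prob 0 1).
(* Repeated splitting into even and odd positions gives each [om i] its own infinite block of
   tosses, disjoint from the others. *)
pose om i (x : coins) := phi (evens (iter i odds x)).
have mit i : measurable_fun [set: coins] (iter i odds).
  elim: i => [|i IH]; first exact: measurable_id.
  rewrite (_ : iter i.+1 odds = odds \o iter i odds)//.
  by apply: measurableT_comp => //; exact: measurable_odds.
have mom i : measurable_fun [set: coins] (om i).
  apply: (measurableT_comp (f := phi \o evens)) => //.
  by apply: measurableT_comp => //; exact: measurable_evens.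
(* Induction: [om 0] sees the even tosses, and [om i.+1] is [om i] after [odds]. *)
have joint n (B : nat -> set R) : (forall i, measurable (B i)) ->
    @coin_tossing R (\bigcap_(i in `I_n) (om i @^-1` B i)) =
    (\prod_(i < n) normal_prob 0 1 (B i))%E.
  elim: n B => [|n IH] B mB.
    by rewrite II0 bigcap_set0 big_ord0 probability_setT.
  rewrite big_ord_recl/= -(IH (fun i => B i.+1))// -phiN// -evens_odds_independent.
  - congr (coin_tossing _); apply/seteqP; split=> x /=.
      move=> h; split; first exact: (h 0%N).
      by move=> i ni; have := h i.+1 ni; rewrite /om /= -iterSr.
    by move=> [h0 h1] [|i] ni; [exact: h0|have := h1 i ni; rewrite /om /= -iterSr].
  - exact: measurable_preimage.
  - by apply: bigcap_measurableType => i _; exact: measurable_preimage.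
have marginal i (B : set R) : measurable B ->
    @coin_tossing R (om i @^-1` B) = normal_prob 0 1 B.
  move=> mB; pose B' j := if j == i then B else setT.
  have := joint i.+1 B'; rewrite big_ord_recr/= big1.
    rewrite /B' eqxx mul1e => <-; last by move=> j; case: ifP.
    congr (coin_tossing _); apply/seteqP; split=> x /=.
      by move=> Bx j _; case: eqP => [->|].
    by move=> /(_ i (ltnSn i)); rewrite eqxx.
  by move=> j _; rewrite /B' ltn_eqF// probability_setT.
exists om; split=> // J B mB.
(* Indices outside [J] get the trivial constraint, which reduces a finite set to an initial
   segment. *)
pose B' j := if j \in J then B j else setT.
have [n Jn] : exists n, forall i, i \in J -> (i < n)%N.
  exists (\max_(i <- J) i).+1 => i iJ; rewrite ltnS.
  exact: leq_bigmax_seq.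
transitivity (@coin_tossing R (\bigcap_(i in `I_n) (om i @^-1` B' i))).
  congr (coin_tossing _); apply/seteqP; split=> x /= h i.
    by move=> ni; rewrite /B'; case: ifP => // iJ; exact: h.
  by move=> iJ; have := h i (Jn i iJ); rewrite /B' iJ.
rewrite joint => [|i]; last by rewrite /B'; case: ifP.
transitivity (\prod_(i <- [seq i <- iota 0 n | i \in J]) normal_prob 0 1 (B i))%E.
  rewrite big_filter [RHS]big_mkcond/= -[in RHS](subn0 n) big_mkord.
  apply: eq_bigr => i _; rewrite /B'; case: ifP => // _.
  by rewrite probability_setT.
rewrite (perm_big (J : seq nat)); last first.
  apply: uniq_perm; [by rewrite filter_uniq// iota_uniq|exact: fset_uniq|].
  move=> i; rewrite mem_filter mem_iota/= add0n andb_idr//; exact: Jn.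
by apply: eq_bigr => i _; exact/esym/marginal.
Qed.

End normal_sequence.

(** * Gaussian moments *)

Section gaussian_moments.
Context {R : realType}.
Local Notation lambda := (@lebesgue_measure R).
Implicit Types (m s : R).

(** The density and the Radon-Nikodym derivative have the same integral over every measurable set,
    so they agree almost everywhere. *)
Lemma ge0_integral_normal_prob m s (f : R -> \bar R) :
  measurable_fun [set: R] f -> (forall x, 0 <= f x)%E ->
  (\int[normal_prob m s]_x f x = \int[lambda]_x (f x * (normal_pdf m s x)%:E))%E.
Proof.
move=> mf f0; pose nu := normal_prob m s; pose mu := lambda.
have numu : nu `<< mu by exact: normal_prob_dominates.
rewrite -(@Radon_Nikodym_SigmaFinite.change_of_variables _ _ R nu mu numu)//.
have mp : measurable_fun [set: R] (fun x => (normal_pdf m s x)%:E).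
  by apply/measurable_EFinP; exact: measurable_normal_pdf.
have mg := measurable_int _ (Radon_Nikodym_SigmaFinite.f_integrable numu).
apply: ae_eq_integral => //; [exact: emeasurable_funM|exact: emeasurable_funM|].
have : ae_eq mu setT (fun x => (normal_pdf m s x)%:E) (Radon_Nikodym_SigmaFinite.f nu mu).
  apply: integral_ae_eq => //; first exact: integrable_normal_pdf.
  by move=> E _ mE; rewrite -Radon_Nikodym_SigmaFinite.f_integral.
by apply: filterS => x /= h _; rewrite h.
Qed.

(* Since [y <= exp y], the factor [(x - m)^2] is absorbed by half of the exponent,
   which leaves a normal density of variance [2 s^2]. *)
Lemma normal_prob_sqr_lty m s : s != 0 ->
  (\int[normal_prob m s]_x (x ^+ 2)%:E < +oo)%E.
Proof.
move=> s0; rewrite ge0_integral_normal_prob//; first last.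
- by move=> x; rewrite lee_fin sqr_ge0.
- by apply/measurable_EFinP; exact: measurable_funX.
pose s' := Num.sqrt 2 * s.
have s'0 : s' != 0 by rewrite mulf_neq0// gt_eqF// sqrtr_gt0.
have s's : s' ^+ 2 = 2 * s ^+ 2 by rewrite exprMn sqr_sqrtr.
have p's0 := normal_peak_gt0 s'0; have ps0 := normal_peak_gt0 s0.
(* The factor [8 * s ^+ 2] turns [y] below into [2 (x - m)^2]; the quotient of peaks corrects the
   normalization. *)
pose C := 8 * s ^+ 2 * normal_peak s / normal_peak s'.
have C0 : 0 <= C.
  apply: divr_ge0; last exact: normal_peak_ge0.
  by apply: mulr_ge0; [apply: mulr_ge0 => //; exact: sqr_ge0|exact: normal_peak_ge0].
have D0 : 0 <= 2 * m ^+ 2 by rewrite mulr_ge0 ?sqr_ge0.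
have mp t : measurable_fun [set: R] (fun x => (normal_pdf m t x)%:E).
  by apply/measurable_EFinP; exact: measurable_normal_pdf.
have mpc c t : measurable_fun [set: R] (fun x => (c%:E * (normal_pdf m t x)%:E)%E).
  by apply: measurable_funeM; exact: mp.
have mx2 : measurable_fun [set: R] (fun x => ((x ^+ 2)%:E * (normal_pdf m s x)%:E)%E).
  apply: emeasurable_funM; last exact: mp.
  by apply/measurable_EFinP; exact: measurable_funX.
apply: (@le_lt_trans _ _ (\int[lambda]_x ((2 * m ^+ 2)%:E * (normal_pdf m s x)%:E
    + C%:E * (normal_pdf m s' x)%:E))%E); last first.
  rewrite ge0_integralD//=; first last.
  - exact: mpc.
  - by move=> x _; rewrite mule_ge0 ?lee_fin// normal_pdf_ge0.
  - exact: mpc.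
  - by move=> x _; rewrite mule_ge0 ?lee_fin// normal_pdf_ge0.
  rewrite !ge0_integralZl//=; first last.
  - by move=> x _; rewrite lee_fin normal_pdf_ge0.
  - exact: mp.
  - by move=> x _; rewrite lee_fin normal_pdf_ge0.
  - exact: mp.
  by rewrite !integral_normal_pdf !mule1 -EFinD ltry.
apply: ge0_le_integral => //=.
- by move=> x _; rewrite mule_ge0 ?lee_fin ?sqr_ge0// normal_pdf_ge0.
- exact: emeasurable_funD (mpc _ _) (mpc _ _).
move=> x _; rewrite -!EFinM -EFinD lee_fin !normal_pdfE//.
have -> : C * (normal_peak s' * normal_fun m s' x) =
    8 * s ^+ 2 * normal_peak s * normal_fun m s' x.
  by rewrite /C; field; rewrite gt_eqF.
pose y := (x - m) ^+ 2 / (4 * s ^+ 2).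
have s20 : 0 < s ^+ 2 by rewrite exprn_even_gt0.
have y0 : 0 <= y by rewrite /y divr_ge0 ?sqr_ge0// mulr_ge0// ltW.
have fs : normal_fun m s x = expR (- y) * expR (- y).
  by rewrite /normal_fun -expRD /y; congr expR; field.
have fs' : normal_fun m s' x = expR (- y).
  by rewrite /normal_fun s's /y; congr expR; field.
have xm : (x - m) ^+ 2 = 4 * s ^+ 2 * y by rewrite /y; field.
rewrite fs fs'.
have ey : y * expR (- y) <= 1.
  rewrite expRN ler_pdivrMr ?expR_gt0// mul1r.
  by rewrite (le_trans _ (expR_ge1Dx y))// lerDr.
(* The bound is [x^2 <= 2 m^2 + 2 (x - m)^2], which amounts to [(x - 2m)^2 >= 0]. *)
have x2 : x ^+ 2 <= 2 * m ^+ 2 + 8 * s ^+ 2 * y.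
  have : 0 <= (x - m - m) ^+ 2 by exact: sqr_ge0.
  have -> : 8 * s ^+ 2 * y = 2 * (x - m) ^+ 2 by rewrite xm; ring.
  by nra.
have e0 := expR_gt0 (- y).
set e := expR (- y) in ey e0 *; set p := normal_peak s in ps0 *.
have pe : 0 < p * (e * e) by rewrite !mulr_gt0.
apply: (@le_trans _ _ ((2 * m ^+ 2 + 8 * s ^+ 2 * y) * (p * (e * e)))).
  by rewrite ler_pM2r.
rewrite mulrDl lerD2l.
rewrite (_ : _ * _ = (8 * s ^+ 2 * p * e) * (y * e)); last by ring.
by rewrite ler_piMr//; apply: ltW; do 3 apply: mulr_gt0 => //.
Qed.

Let p (x : R) : R := normal_peak 1 * expR (- x ^+ 2 / 2).

Let pE : normal_pdf 0 1 = p.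
Proof.
apply/funext => x; rewrite normal_pdfE ?oner_neq0// /p /normal_fun subr0.
by rewrite expr1n.
Qed.

Let p_ge0 x : 0 <= p x. Proof. by rewrite -pE normal_pdf_ge0. Qed.

Let cp : continuous p.
Proof. by rewrite -pE; apply: continuous_normal_pdf; rewrite oner_neq0. Qed.

Let is_derive_xp (x : R) : is_derive x 1 (fun x => x * p x) ((1 - x ^+ 2) * p x).
Proof.
have de : is_derive x 1 (fun x : R => expR (- x ^+ 2 / 2)) (- x * expR (- x ^+ 2 / 2)).
  have d1 : is_derive x 1 (fun x : R => - x ^+ 2 / 2) (- x).
    by apply: is_derive_eq; rewrite ?scaler0 ?add0r /GRing.scale/=; field.
  have := @is_derive1_comp R expR (fun x : R => - x ^+ 2 / 2) x _ _ _ d1.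
  by move=> /(_ _ (is_derive_expR _)); rewrite mulrC.
rewrite /p; apply: is_derive_eq.
by rewrite /GRing.scale/=; ring.
Qed.

Let cvg_xp : x * p x @[x --> +oo] --> (0 : R).
Proof.
have c0 : 0 < normal_peak 1 :> R by rewrite normal_peak_gt0 ?oner_neq0.
apply/cvgrPdist_le => e e0; near=> x.
have x0 : 0 < x by near: x; exact: nbhs_pinfty_gt.
have xp0 : 0 <= x * p x by exact: mulr_ge0 (ltW x0) (p_ge0 x).
rewrite sub0r normrN (ger0_norm xp0).
(* From [y < exp y] at [y = x^2 / 2], the product [x * p x] is at most a constant over [x]. *)
have : x ^+ 2 / 2 < expR (x ^+ 2 / 2).
  by rewrite (lt_le_trans _ (expR_ge1Dx _))// ltrDr.
rewrite /p mulNr expRN => h.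
apply: (@le_trans _ _ (2 * normal_peak 1 / x)).
  rewrite ler_pdivlMr// mulrAC mulrA ler_pdivrMr ?expR_gt0//.
  by nra.
rewrite ler_pdivrMr// -ler_pdivrMl//.
Unshelve. all: by end_near. Qed.

(* [(1 - x^2) p] is the derivative of [x p]; splitting at [x = 1] keeps all
   integrands nonnegative. *)
Lemma integral_normal_prob_sqr : (\int[normal_prob (0 : R) 1]_x (x ^+ 2)%:E = 1)%E.
Proof.
rewrite ge0_integral_normal_prob//; first last.
- by move=> x; rewrite lee_fin sqr_ge0.
- by apply/measurable_EFinP; exact: measurable_funX.
rewrite -(integral_normal_pdf (0 : R) 1) pE.
under eq_integral do rewrite -EFinM.
have cx2p : continuous (fun x : R => x ^+ 2 * p x).
  by move=> x; apply: cvgM; [exact: exprn_continuous|exact: cp].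
(* Both integrands are even, so it suffices to compare them on the half-line. *)
rewrite !ge0_symfun_integralT//; first last.
- by move=> x/=; rewrite /p !sqrrN.
- by move=> x; rewrite mulr_ge0 ?sqr_ge0.
- by move=> x/=; rewrite /p !sqrrN.
congr (_ * _)%E.
have -> : [set x : R | 0 <= x] = `[0, 1[ `|` `[1, +oo[.
  apply/seteqP; split=> x /=; rewrite !in_itv/= ?andbT.
    by move=> ->; case: (ltP x 1) => ?; [left|right].
  by case=> [/andP[]//|]; apply: le_trans.
have mf (f : R -> R) (A : set R) : continuous f -> measurable A ->
    measurable_fun A (EFin \o f).
  move=> cf mA; apply/measurable_EFinP/measurable_funTS.
  exact: continuous_measurable_fun.
have dj : [disjoint (`[0, 1[%classic : set R) & (`[1, +oo[%classic : set R)].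
  rewrite disj_set2E; apply/eqP/seteqP; split=> x //=; rewrite !in_itv/= andbT.
  by move=> [/andP[_ x1] /(lt_le_trans x1)]; rewrite ltxx.
have intc (f : R -> R) : continuous f ->
    (\int[lambda]_(x in `[0%R, 1%R[) (f x)%:E =
     \int[lambda]_(x in `[0%R, 1%R]) (f x)%:E)%E.
  by move=> cf; rewrite integral_itv_bndo_bndc//; exact: mf.
rewrite !ge0_integral_setU//=; first last.
- by move=> x _; rewrite lee_fin mulr_ge0 ?sqr_ge0.
- by apply: mf => //; exact: measurableU.
- by move=> x _; rewrite lee_fin.
- by apply: mf => //; exact: measurableU.
rewrite !intc//.
have c1 : continuous (fun x : R => (x ^+ 2 - 1) * p x).
  move=> x; apply: cvgM; last exact: cp.
  by apply: (@cvgB _ R^o); [exact: exprn_continuous|exact: cst_continuous].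
have c2 : continuous (fun x : R => (1 - x ^+ 2) * p x).
  move=> x; apply: cvgM; last exact: cp.
  by apply: (@cvgB _ R^o); [exact: cst_continuous|exact: exprn_continuous].
have cxp : continuous (fun x : R => x * p x).
  by move=> x; apply: cvgM; [exact: cvg_id|exact: cp].
(* The surplus of [x^2 p] over [p] beyond 1 and its deficit on [[0, 1]] both equal [p 1], so they
   cancel. *)
have I1 : (\int[lambda]_(x in `[1%R, +oo[) ((x ^+ 2 - 1) * p x)%:E = (p 1)%:E)%E.
  rewrite (@ge0_continuous_FTC2y _ _ (fun x => - (x * p x)) _ 0).
  - by rewrite mul1r EFinN sub0e oppeK.
  - by move=> x x1; rewrite mulr_ge0// subr_ge0 exprn_ege1.
  - exact: continuous_subspaceT.
  - by rewrite -oppr0; apply: cvgN; exact: cvg_xp.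
  - by move=> x _; apply: derivableN; have [] := is_derive_xp x.
  - by apply: cvgN; apply: cvg_at_right_filter; exact: cxp.
  - move=> x _; rewrite derive1E deriveN; last by have [] := is_derive_xp x.
    by rewrite (@derive_val _ _ _ _ _ _ _ (is_derive_xp x)); ring.
have I2 : (\int[lambda]_(x in `[0%R, 1%R]) ((1 - x ^+ 2) * p x)%:E = (p 1)%:E)%E.
  rewrite (@continuous_FTC2 _ _ (fun x => x * p x)) ?ltr01//.
  - by rewrite mul0r mul1r sube0.
  - exact: continuous_subspaceT.
  - split.
    + by move=> x _; have [] := is_derive_xp x.
    + by apply: cvg_at_right_filter; exact: cxp.
    + by apply: cvg_at_left_filter; exact: cxp.
  - by move=> x _; rewrite derive1E (@derive_val _ _ _ _ _ _ _ (is_derive_xp x)).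
have -> : (\int[lambda]_(x in `[1%R, +oo[) (x ^+ 2 * p x)%:E =
    (p 1)%:E + \int[lambda]_(x in `[1%R, +oo[) (p x)%:E)%E.
  rewrite -I1 -ge0_integralD//=.
  - by apply: eq_integral => x _; rewrite -EFinD; congr EFin; ring.
  - move=> x; rewrite in_itv/= andbT => x1.
    by rewrite lee_fin mulr_ge0// subr_ge0 exprn_ege1.
  - exact: mf.
  - by move=> x _; rewrite lee_fin.
  - exact: mf.
have -> : (\int[lambda]_(x in `[0%R, 1%R]) (p x)%:E =
    (p 1)%:E + \int[lambda]_(x in `[0%R, 1%R]) (x ^+ 2 * p x)%:E)%E.
  rewrite -I2 -ge0_integralD//=.
  - by apply: eq_integral => x _; rewrite -EFinD; congr EFin; ring.
  - move=> x; rewrite in_itv/= => /andP[x0 x1].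
    by rewrite lee_fin mulr_ge0// subr_ge0 exprn_ile1.
  - exact: mf.
  - by move=> x _; rewrite lee_fin mulr_ge0 ?sqr_ge0.
  - exact: mf.
by rewrite addeCA addeA.
Qed.

End gaussian_moments.

(** * The law of a generated process *)

Section laws.
Context {R : realType}.

(** * Variables with the same law *)

Section law_transfer.
Context {d1 d2 d'} {O1 : measurableType d1} {O2 : measurableType d2}
  {S : measurableType d'} (P1 : probability O1 R) (P2 : probability O2 R)
  (f1 : O1 -> S) (f2 : O2 -> S).
Hypotheses (mf1 : measurable_fun [set: O1] f1) (mf2 : measurable_fun [set: O2] f2).
Hypothesis same_law : forall B, measurable B -> P1 (f1 @^-1` B) = P2 (f2 @^-1` B).

Lemma ge0_integral_same_law (F : S -> \bar R) :
  measurable_fun [set: S] F -> (forall x, 0 <= F x)%E ->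
  (\int[P1]_w F (f1 w) = \int[P2]_w F (f2 w))%E.
Proof.
move=> mF F0.
transitivity (\int[pushforward P1 f1]_x F x)%E.
  by rewrite ge0_integral_pushforward.
transitivity (\int[pushforward P2 f2]_x F x)%E.
  by apply: eq_measure_integral => B mB _; exact: same_law.
by rewrite ge0_integral_pushforward.
Qed.

Lemma integrable_same_law (F : S -> R) : measurable_fun [set: S] F ->
  P1.-integrable setT (fun w => (F (f1 w))%:E) ->
  P2.-integrable setT (fun w => (F (f2 w))%:E).
Proof.
move=> mF /integrableP[_ F1]; apply/integrableP; split.
  by apply/measurable_EFinP; exact: measurableT_comp.
have mF' : measurable_fun [set: S] (fun x => `|(F x)%:E|%E).
  by apply: measurableT_comp => //; exact/measurable_EFinP.
by rewrite -(ge0_integral_same_law mF')// => x; exact: abse_ge0.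
Qed.

Lemma integral_same_law (F : S -> R) : measurable_fun [set: S] F ->
  P1.-integrable setT (fun w => (F (f1 w))%:E) ->
  (\int[P1]_w (F (f1 w))%:E = \int[P2]_w (F (f2 w))%:E)%E.
Proof.
move=> mF iF; have iF2 := integrable_same_law mF iF.
have mF' : measurable_fun [set: S] (EFin \o F) by exact/measurable_EFinP.
transitivity (\int[pushforward P1 f1]_x (EFin \o F) x)%E.
  by rewrite integral_pushforward.
transitivity (\int[pushforward P2 f2]_x (EFin \o F) x)%E.
  by apply: eq_measure_integral => B mB _; exact: same_law.
by rewrite integral_pushforward.
Qed.

End law_transfer.

(** * Square-integrable variables *)

Section square_integrable.
Context {d} {O : measurableType d} (P : probability O R).

Lemma sqr_lty_Lfun2 (f : O -> R) : measurable_fun [set: O] f ->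
  (\int[P]_w (f w ^+ 2)%:E < +oo)%E -> f \in Lfun P 2%:E.
Proof.
move=> mf f2; rewrite inE; apply/andP; split; rewrite inE//=.
rewrite /finite_norm unlock /Lnorm poweR_lty//.
under eq_integral do rewrite /= powR_mulrn// real_normK ?num_real//.
exact: f2.
Qed.

Lemma Lfun2_add_scale (c : R) (f g : O -> R) :
  f \in Lfun P 2%:E -> g \in Lfun P 2%:E -> (fun w => c * f w + g w) \in Lfun P 2%:E.
Proof.
have p1 : (1 <= 2%:E :> \bar R)%E by rewrite lee_fin ler1n.
by move=> lf lg; exact: ((Lfun_submod_closed P p1).2 c f g lf lg).
Qed.

Lemma Lfun2_lincomb I (r : seq I) (c : I -> R) (f : I -> O -> R) :
  (forall i, f i \in Lfun P 2%:E) ->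
  (fun w => \sum_(i <- r) c i * f i w) \in Lfun P 2%:E.
Proof.
move=> lf; elim: r => [|i r IH].
  by under eq_fun do rewrite big_nil; exact: Lfun_cst.
by under eq_fun do rewrite big_cons; exact: Lfun2_add_scale.
Qed.

Lemma Lfun2_mul_integrable (f g : O -> R) :
  f \in Lfun P 2%:E -> g \in Lfun P 2%:E ->
  P.-integrable setT (fun w => (f w * g w)%:E).
Proof. by move=> lf lg; exact/Lfun1_integrable/Lfun2_mul_Lfun1. Qed.

Lemma Lfun2_integrable (f : O -> R) : f \in Lfun P 2%:E ->
  P.-integrable setT (fun w => (f w)%:E).
Proof.
move=> lf; apply/Lfun1_integrable; apply: Lfun_subset12 => //.
exact: fin_num_measure.
Qed.

Lemma gaussian_rv_Lfun2 (Y : O -> R) : gaussian_rv P Y -> Y \in Lfun P 2%:E.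
Proof.
move=> [mY [m [s [s0 lawY]]]]; apply: sqr_lty_Lfun2 => //.
have mX2 : measurable_fun [set: R] (fun x : R => (x ^+ 2)%:E).
  by apply/measurable_EFinP; exact: measurable_funX.
have sq0 (x : R) : (0 <= (x ^+ 2)%:E)%E by rewrite lee_fin sqr_ge0.
have [sE|sN] := eqVneq s 0.
  rewrite (@ge0_integral_same_law _ _ _ _ _ _ P
    (\d_m : probability R R) Y idfun mY (@measurable_id _ _ setT) _
    (fun x => (x ^+ 2)%:E))//.
    by rewrite integral_dirac//= diracT mul1e ltry.
  by move=> B mB; rewrite lawY// sE eqxx.
rewrite (@ge0_integral_same_law _ _ _ _ _ _ P
  (normal_prob m s : probability (measurableTypeR R) R) Y idfun mY
  (@measurable_id _ _ setT) _ (fun x => (x ^+ 2)%:E))//.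
  exact: normal_prob_sqr_lty.
by move=> B mB; rewrite lawY// (negbTE sN).
Qed.

End square_integrable.
End laws.

(** Generators of the cylindrical sigma-algebra: measurability of [X] into it follows from that of
    the values of [X] at each time, and its events are Borel, so [generated_by] applies to them. *)
Definition C0_cylinders {R : realType} (T : R) : set (set (C0 T)) :=
  [set E | exists a (B : set R), [/\ C0_dual T a, measurable B & E = a @^-1` B]].

Arguments C0_cylinders {R} T.

Notation C0cyl T := (g_sigma_algebraType (C0_cylinders T)).

Section cylindrical.
Context {R : realType} {T : R}.
Implicit Types (a : C0 T -> R).

Lemma dual_measurable_cyl a : C0_dual T a ->
  measurable_fun [set: C0cyl T] (a : C0cyl T -> R).
Proof.
by move=> Da _ B mB; rewrite setTI; apply: sub_sigma_algebra; exists a, B.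
Qed.

Lemma measurable_to_cyl d (O : measurableType d) (f : O -> C0 T) :
  (forall a, C0_dual T a -> measurable_fun [set: O] (a \o f)) ->
  measurable_fun [set: O] (f : O -> C0cyl T).
Proof.
move=> mf; apply: (@measurability _ _ O (C0cyl T) setT f (C0_cylinders T)) => //.
move=> _ [_ [a [B [Da mB ->]]] <-]; rewrite setTI.
by rewrite -[X in measurable X]setTI; exact: (mf a Da measurableT B mB).
Qed.

Lemma cyl_borel (B : set (C0cyl T)) : measurable B -> C0_borel B.
Proof.
move: B; apply: smallest_sub; first exact: smallest_sigma_algebra.
move=> _ [a [B [[_ ca] mB ->]]].
pose O := [set U : set (C0 T) | open U].
have ma : measurable_fun [set: g_sigma_algebraType O] (a : g_sigma_algebraType O -> R).
  apply: (measurability _ (RGenOpens.measurableE R)) => _ [_ [x [y ->]] <-].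
  rewrite setTI; apply: sub_sigma_algebra; rewrite /O/=.
  by apply: open_comp => // x _; exact: ca.
by rewrite -[X in C0_borel X]setTI; exact: ma.
Qed.

Lemma dual_lincomb I (r : seq I) (c : I -> R) (a : I -> C0 T -> R) :
  (forall i, C0_dual T (a i)) -> C0_dual T (fun f => \sum_(i <- r) c i * a i f).
Proof.
move=> Da.
have sa : scalar (fun f => \sum_(i <- r) c i * a i f).
  move=> k f g; rewrite mulr_sumr -big_split/=; apply: eq_bigr => i _.
  by rewrite (Da i).1; ring.
split=> //.
have /boolp.choice[M aM] : forall i, exists M, forall f, `|a i f| <= M * `|f|.
  by move=> i; have [? ?] := Da i; exact: scalar_continuous_bounded.
apply: (bounded_scalar_continuous (M := \sum_(i <- r) `|c i| * M i) sa) => f.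
rewrite mulr_suml (le_trans (ler_norm_sum _ _ _))// ler_sum// => i _.
by rewrite normrM -mulrA ler_wpM2l.
Qed.

Lemma dualB a b : C0_dual T a -> C0_dual T b -> C0_dual T (fun f => a f - b f).
Proof.
move=> [sa ca] [sb cb]; split; first by move=> k f g; rewrite sa sb; ring.
by move=> f; apply: (@continuousB _ R^o); [exact: ca|exact: cb].
Qed.

End cylindrical.

(** * Symmetries of a generated process *)

Section generated_process.
Context {R : realType} {T : R} (T_gt0 : 0 < T) {H : hilbertType R}
  (u : {linear H -> C0 T}) {d : measure_display} {Omega : measurableType d}
  (P : probability Omega R) (X : Omega -> C0 T).
Hypothesis X_gaussian : gaussian_process P X.
Hypothesis X_generated : generated_by P X u.

Lemma gaussian_process_eval d0 (O : measurableType d0) (Q : probability O R)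
    (Y : O -> C0 T) t :
  gaussian_process Q Y -> gaussian_rv Q (fun w => Y w t).
Proof.
move=> /(_ 1%N (fun=> 1) (fun=> t)).
by under eq_fun do rewrite big_ord1 mul1r.
Qed.

Lemma dual_process_measurable (a : C0 T -> R) : C0_dual T a ->
  measurable_fun [set: Omega] (a \o X).
Proof.
move=> Da; apply: dual_measurable => // t.
by have [] := gaussian_process_eval t X_gaussian.
Qed.

Lemma process_measurable_cyl : measurable_fun [set: Omega] (X : Omega -> C0cyl T).
Proof. by apply: measurable_to_cyl => a; exact: dual_process_measurable. Qed.

Lemma dual_series (a : C0 T -> R) (h : nat -> H) (x : nat -> R) (f : C0 T) :
  C0_dual T a -> series (fun i => x i *: u (h i)) @ \oo --> f ->
  \sum_(0 <= i < n) x i * a (u (h i)) @[n --> \oo] --> a f.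
Proof.
move=> [sa ca] xf.
rewrite [X in X @ _ --> _](_ : _ = a \o series (fun i => x i *: u (h i))).
  exact: (cvg_comp _ _ xf (ca f)).
apply/funext => n /=; rewrite /series/= scalar_fun_sum//.
by apply: eq_bigr => i _; rewrite scalar_funZ.
Qed.

(** Signs are absorbed into the coefficients, so the span does not change. *)
Lemma orthonormal_basis_sign (h : nat -> H) (b : nat -> bool) :
  orthonormal_basis [set: H] h ->
  orthonormal_basis [set: H] (fun i => (-1) ^+ b i *: h i).
Proof.
have ss i : (-1) ^+ b i * (-1) ^+ b i = 1 :> R by rewrite -expr2 sqrr_sign.
move=> [[ho hu hz] hH]; split; last first.
  rewrite -hH; congr closure; apply/seteqP; split=> x [n [c [v [vh ->]]]].
    have /boolp.choice[k hk] : forall i, exists k, (-1) ^+ b k *: h k = v i.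
      by move=> i; have [k _ <-] := vh i; exists k.
    exists n, (fun i => c i * (-1) ^+ b (k i)), (fun i => h (k i)); split=> [i|].
      by exists (k i).
    by apply: eq_bigr => i _; rewrite -hk scalerA.
  have /boolp.choice[k hk] : forall i, exists k, h k = v i.
    by move=> i; have [k _ <-] := vh i; exists k.
  exists n, (fun i => c i * (-1) ^+ b (k i)), (fun i => (-1) ^+ b (k i) *: h (k i)).
  split=> [i|]; first by exists (k i).
  by apply: eq_bigr => i _; rewrite -hk scalerA -mulrA ss mulr1.
split.
- by move=> i j ij; rewrite innerZl innerZr ho// !mulr0.
- move=> i; rewrite innerZl innerZr mulrA ss mul1r.
  by have [->|->] := hu i; [left|right; rewrite scaler0].
- move=> i j ij /eqP; rewrite scaler_eq0 signr_eq0/= => /eqP /(hz _ _ ij) ->.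
  by rewrite scaler0.
Qed.

(* Flipping the signs of some basis vectors again gives an orthonormal basis,
   hence a series with the same law, on the same probability space. *)
Lemma reflection_principle (h : nat -> H) (b : nat -> bool) (F : C0 T -> R) :
  orthonormal_basis [set: H] h ->
  measurable_fun [set: C0cyl T] (F : C0cyl T -> R) ->
  P.-integrable setT (fun w => (F (X w))%:E) ->
  (forall f g : C0 T, (forall a (c : R), C0_dual T a ->
    (forall i, (-1) ^+ b i * a (u (h i)) = c * a (u (h i))) -> a g = c * a f) ->
    F g = - F f) ->
  (\int[P]_w (F (X w))%:E = 0)%E.
Proof.
move=> hb mF iF Fodd.
have [om omN] := @exists_independent_standard_normal R.
have [S1 [mS1 cS1 lawS1]] := X_generated hb omN.
have [S2 [mS2 cS2 lawS2]] := X_generated (orthonormal_basis_sign b hb) omN.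
have mX := process_measurable_cyl.
have mcyl (S : coins -> C0 T) : (forall B, C0_borel B -> measurable (S @^-1` B)) ->
    measurable_fun [set: coins] (S : coins -> C0cyl T).
  by move=> mS _ B mB; rewrite setTI; apply: mS; exact: cyl_borel.
have m1 := mcyl _ mS1; have m2 := mcyl _ mS2.
have law1 (B : set (C0cyl T)) : measurable B -> P (X @^-1` B) = coin_tossing (S1 @^-1` B).
  by move=> mB; rewrite lawS1//; exact: cyl_borel.
have law2 (B : set (C0cyl T)) : measurable B -> P (X @^-1` B) = coin_tossing (S2 @^-1` B).
  by move=> mB; rewrite lawS2//; exact: cyl_borel.
have i1 := integrable_same_law mX m1 law1 mF iF.
have I1 := integral_same_law mX m1 law1 mF iF.
have I2 := integral_same_law mX m2 law2 mF iF.
(* [S1] and [S2] are built from the same normals and both have the law of [X]; oddness makes the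
   mean equal to its own negative. *)
have : (\int[P]_w (F (X w))%:E = - \int[P]_w (F (X w))%:E)%E.
  rewrite {1}I2 I1 -integralN/=; last exact: integrable_add_def.
  apply: ae_eq_integral => //.
  - by apply/measurable_EFinP; exact: (measurableT_comp (f := F : C0cyl T -> R)).
  - apply/measurable_EFinP/measurable_funN.
    exact: (measurableT_comp (f := F : C0cyl T -> R)).
  - apply: filterS2 cS1 cS2 => w c1 c2 _ /=; congr EFin.
    apply: Fodd => a c Da ac.
    have l1 := dual_series Da c1; have l2 := dual_series Da c2.
    (* Under [a] the terms of the reflected series are [c] times the original ones, and this passes
       to the limit. *)
    apply: (@cvg_unique _ (@Rhausdorff R) _ _ _ _ l2).
    rewrite (_ : (fun n => _) =
        (fun n => c * \sum_(0 <= i < n) om i w * a (u (h i)))).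
      by apply: cvgM; [exact: cvg_cst|exact: l1].
    apply/funext => n; rewrite mulr_sumr; apply: eq_bigr => i _.
    by rewrite linearZ/= (scalar_funZ Da.1) ac; ring.
have fin : (\int[P]_w (F (X w))%:E)%E \is a fin_num by exact: integrable_fin_num.
rewrite -(fineK fin); set r := fine _ => /eqP; rewrite -EFinN eqe => /eqP rN.
by congr EFin; lra.
Qed.

(** [a] extracts the [k]-th coefficient from the series, so [a \o X] is standard normal. *)
Lemma integral_standard_functional_sqr (h : nat -> H) k (a : C0 T -> R) :
  orthonormal_basis [set: H] h -> C0_dual T a ->
  (forall i, a (u (h i)) = (i == k)%:R) ->
  (\int[P]_w (a (X w) ^+ 2)%:E = 1)%E.
Proof.
move=> hb Da ah.
have [om omN] := @exists_independent_standard_normal R.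
have [S [mS cS lawS]] := X_generated hb omN.
have [mom lawom _] := omN.
have maX : measurable_fun [set: Omega] (a \o X) by exact: dual_process_measurable.
have mcyl : measurable_fun [set: coins] (S : coins -> C0cyl T).
  by move=> _ B mB; rewrite setTI; apply: mS; exact: cyl_borel.
have maS : measurable_fun [set: coins] (a \o S).
  by apply: (measurableT_comp (f := a : C0cyl T -> R)) => //; exact: dual_measurable_cyl.
have mX2 : measurable_fun [set: R] (fun x : R => (x ^+ 2)%:E).
  by apply/measurable_EFinP; exact: measurable_funX.
have sq0 (x : R) : (0 <= (x ^+ 2)%:E)%E by rewrite lee_fin sqr_ge0.
rewrite (@ge0_integral_same_law _ _ _ _ _ _ _ P coin_tossing
  (a \o X) (a \o S) maX maS _ (fun x => (x ^+ 2)%:E))//; last first.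
  move=> B mB; rewrite -(lawS (a @^-1` B))//; apply: cyl_borel.
  by apply: sub_sigma_algebra; exists a, B.
transitivity (\int[coin_tossing]_w ((om k w) ^+ 2)%:E)%E.
  apply: ae_eq_integral => //.
  - exact: measurableT_comp mX2 maS.
  - exact: measurableT_comp mX2 (mom k).
  - apply: filterS cS => w cw _; congr ((_ ^+ 2)%:E).
    apply: (@cvg_unique _ (@Rhausdorff R) _ _ _ _ (dual_series Da cw)).
    apply: cvg_near_cst; exists k.+1 => // n /= kn.
    rewrite (bigD1_seq k)/= ?mem_index_iota ?iota_uniq ?kn//.
    rewrite big1 ?addr0 ?ah ?eqxx ?mulr1// => i ik.
    by rewrite ah (negbTE ik) mulr0.
rewrite (@ge0_integral_same_law _ _ _ _ _ _ _ coin_tossing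
  (normal_prob (0 : R) 1) (om k) idfun (mom k) (@measurable_id _ _ setT) _
  (fun x => (x ^+ 2)%:E))//.
  exact: integral_normal_prob_sqr.
by move=> B mB; rewrite lawom.
Qed.

End generated_process.

(** * Conditioning *)

Section conditions.
Context {R : realType} {T : R}.
Implicit Types (A : set (C0 T -> R)).

(** Events are described on path space, where a path can be compared with its reflection. *)
Definition condition_events A : set (set (C0 T)) :=
  [set D | exists a (B : set R), [/\ A a, measurable B & D = a @^-1` B]].

Lemma sigma_of_conditionsE d (Omega : measurableType d) (X : Omega -> C0 T) A E :
  sigma_of_conditions X A E -> exists2 D, <<s condition_events A >> D & E = X @^-1` D.
Proof.
rewrite /sigma_of_conditions (_ : [set E | _] =
    preimage_set_system setT X (condition_events A)).
  rewrite g_sigma_preimageE => -[D mD <-]; exists D => //.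
  by rewrite setTI.
apply/seteqP; split=> [_ [a [B [Aa mB ->]]]|_ [_ [a [B [Aa mB ->]]] <-]].
  by exists (a @^-1` B); [exists a, B|rewrite setTI].
by exists a, B; split=> //; rewrite setTI.
Qed.

(** Sets that do not separate [f] from [g] form a sigma-algebra. Hence a reflection preserving all
    conditions preserves the indicators of their events. *)
Lemma condition_events_saturated A (f g : C0 T) D :
  (forall a, A a -> a f = a g) -> <<s condition_events A >> D -> D f = D g.
Proof.
move=> fg; move: D; apply: smallest_sub.
  split=> [|D Dfg|F Ffg]; first by [].
    by rewrite /setD/= Dfg.
  by apply/propext; split=> -[n _ Fn]; exists n => //; rewrite ?Ffg// -Ffg.
by move=> _ [a [B [Aa _ ->]]]; rewrite /= fg.
Qed.

Lemma condition_events_cyl A (D : set (C0cyl T)) : A `<=` C0_dual T ->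
  <<s condition_events A >> D -> measurable D.
Proof.
move=> AD; move: D; apply: smallest_sub; first exact: sigma_algebra_measurable.
by move=> _ [a [B [/AD Da mB ->]]]; apply: sub_sigma_algebra; exists a, B.
Qed.

End conditions.

Lemma integral_mul_lincomb {R : realType} {d} {O : measurableType d}
    (P : probability O R) I (r : seq I) (c : I -> R) (Y : O -> R) (f : I -> O -> R) :
  Y \in Lfun P 2%:E -> (forall i, f i \in Lfun P 2%:E) ->
  (\int[P]_w (Y w * \sum_(i <- r) c i * f i w)%:E =
   \sum_(i <- r) (c i)%:E * \int[P]_w (Y w * f i w)%:E)%E.
Proof.
move=> lY lf; have iYf i := Lfun2_mul_integrable lY (lf i).
transitivity (\int[P]_w (\sum_(i <- r) (c i)%:E * (Y w * f i w)%:E))%E.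
  apply: eq_integral => w _; rewrite mulr_sumr -sumEFin.
  by apply: eq_bigr => i _; rewrite -EFinM; congr EFin; ring.
rewrite integral_sum//; last by move=> i; exact: integrableZl.
by apply: eq_bigr => i _; rewrite integralZl.
Qed.

(** * The covariance of the conditioned process *)

Theorem proposition2p3 (R : realType) (T : R) (T_gt0 : 0 < T)
  (H : hilbertType R) (H_separable : separable H)
  (u : {linear H -> C0 T})
  (u_bounded : exists M : R, forall h : H, `|u h| <= M * `|h|)
  (d : measure_display) (Omega : measurableType d) (P : probability Omega R)
  (X : Omega -> C0 T)
  (X_gaussian : gaussian_process P X) (X_centered : centered P X)
  (X_generated : generated_by P X u)
  (N : nat) (A : set (C0 T -> R))
  (A_conditions : A `<=` C0_dual T) (A_card : (A #= `I_N)%card)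
  (d' : measure_display) (Omega' : measurableType d')
  (P' : probability Omega' R) (XA : Omega' -> C0 T)
  (XA_conditioned : conditioned_process P X A P' XA)
  (e : 'I_N -> H) (e_basis : orthonormal_basis (detached_space u A) e)
  (s t : `[0, T]%classic) :
  (covariance_function P' XA s t =
   covariance_function P X s t - (\sum_(i < N) u (e i) s * u (e i) t)%:E)%E.
Proof.
have [f [fA _ fsurj]] : exists f : nat -> C0 T -> R, set_bij `I_N A f.
  by apply/card_set_bijP; rewrite card_eq_sym.
pose a (j : 'I_N) := f j.
have Aa j : A (a j) by apply: fA => /=.
have aA b : A b -> exists j, b = a j.
  by move=> /fsurj[n /= nN <-]; exists (Ordinal nN).
have Da j : C0_dual T (a j) by exact: A_conditions.
have sau b : C0_dual T b -> scalar (b \o u).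
  by move=> [sb _] k x y /=; rewrite linearP sb.
have cau b : C0_dual T b -> continuous (b \o u).
  move=> Db; have [M uM] := u_bounded.
  have [Mb bM] := scalar_continuous_bounded Db.1 Db.2.
  apply: (bounded_scalar_continuous (M := `|Mb| * M) (sau b Db)) => h.
  rewrite (le_trans (bM _))// -mulrA.
  by rewrite (le_trans (ler_wpM2r (normr_ge0 _) (ler_norm Mb)))// ler_wpM2l.
have [e_pad e_closure] := e_basis; have [eo eu _] := e_pad.
have e_detached i : detached_space u A (e i).
  rewrite -e_closure; apply: subset_closure.
  exists 1%N, (fun=> 1), (fun=> e i); split=> [_|]; first by exists i.
  by rewrite big_ord1 scale1r.
(* Since [e i] is orthogonal to the reduced space, its inner product vanishes on the common kernel
   of the [a j \o u], hence is a combination of them. For a padding zero the coefficients are set to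
   0, so that [L i] vanishes on all paths and not only on the range of [u]. *)
have /boolp.choice[c cP] : forall i, exists c : 'I_N -> R,
    (forall x, inner (e i) x = \sum_j c j * a j (u x)) /\ (e i = 0 -> forall j, c j = 0).
  move=> i; have [->|ei0] := eqVneq (e i) 0.
    by exists (fun=> 0); split=> // x; rewrite inner0l big1// => j _; rewrite mul0r.
  have [|c Hc] := kernel_combination (fun j => sau _ (Da j)) (@inner_scalar _ _ (e i)).
    by move=> x ax; apply: e_detached => b /aA[j ->]; exact: ax.
  by exists c; split=> // /eqP; rewrite (negbTE ei0).
pose L i (g : C0 T) := \sum_j c i j * a j g.
have DL i : C0_dual T (L i) by exact: dual_lincomb.
have Lu i x : L i (u x) = inner (e i) x by rewrite (cP i).1.
have L0 i g : e i = 0 -> L i g = 0.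
  by move=> ei0; rewrite /L big1// => j _; rewrite (cP i).2// mul0r.
(* [L i] extends the [i]-th coordinate to all paths; [W r] is the evaluation at [r] minus its part
   along the conditions. *)
pose W r (g : C0 T) := g r - \sum_i u (e i) r * L i g.
have DW r : C0_dual T (W r).
  by apply: dualB; [exact: eval_dual|exact: dual_lincomb].
pose Z r w := \sum_i u (e i) r * L i (X w).
have [h [hb hcase hex]] := adapted_basis H_separable e_pad.
have [[ho hu _] _] := hb.
have b_orth k b : A b -> (forall i, inner (e i) (h k) = 0) -> b (u (h k)) = 0.
  move=> Ab; apply: (inner_adjoint_orthocompl H_separable e_closure Ab).
  - exact: sau (A_conditions _ Ab).
  - exact: cau (A_conditions _ Ab).
(* [b1] marks the basis vectors in the reduced space, padding zeros included; the first reflection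
   changes their signs. *)
pose b1 k := [forall i, inner (e i) (h k) == 0].
have b1P k : b1 k -> forall i, inner (e i) (h k) = 0.
  by move=> /forallP h0 i; exact/eqP.
have b1A k b : A b -> (-1) ^+ b1 k * b (u (h k)) = 1 * b (u (h k)).
  move=> Ab; case: (boolP (b1 k)) => [/b1P|_]; last by rewrite expr0.
  by move=> /(b_orth k b Ab) ->; rewrite !mulr0.
have b1L k i : (-1) ^+ b1 k * L i (u (h k)) = 1 * L i (u (h k)).
  rewrite Lu; case: (boolP (b1 k)) => [/b1P ->|_]; last by rewrite expr0.
  by rewrite !mulr0.
have b1W k r : (-1) ^+ b1 k * W r (u (h k)) = -1 * W r (u (h k)).
  case: (boolP (b1 k)) => [|]; first by rewrite expr1.
  (* An unmarked basis vector is some [e i], and [W r] vanishes on its image under [u]. *)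
  have [[i hk]|h0] := hcase k; last first.
    by move=> /negP[]; apply/forallP => i; exact/eqP.
  move=> _; suff -> : W r (u (h k)) = 0 by rewrite !mulr0.
  rewrite /W (bigD1 i)//= big1 ?addr0.
    rewrite Lu hk; have [->|->] := eu i; first by rewrite mulr1 subrr.
    by rewrite inner0r mulr0 subr0 linear0.
  by move=> j ji; rewrite Lu hk eo ?mulr0.
have LX r : (fun w => X w r) \in Lfun P 2%:E.
  by apply: gaussian_rv_Lfun2; exact: gaussian_process_eval.
have maX b : C0_dual T b -> measurable_fun [set: Omega] (fun w => b (X w)).
  by move=> Db; exact: (dual_process_measurable T_gt0 X_gaussian Db).
have L_sqr i : e i != 0 -> (\int[P]_w (L i (X w) ^+ 2)%:E = 1)%E.
  move=> ei0; have [k hk] := hex i ei0.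
  apply: (integral_standard_functional_sqr T_gt0 X_gaussian X_generated
    (k := k) hb (DL i)) => m.
  rewrite Lu -hk; have [->|mk] := eqVneq m k; last by rewrite ho// eq_sym.
  by have [//|hk0] := hu k; rewrite -hk hk0 eqxx in ei0.
have LL i : (fun w => L i (X w)) \in Lfun P 2%:E.
  have [ei0|ei0] := eqVneq (e i) 0.
    by under eq_fun do rewrite (L0 i _ ei0); exact: Lfun_cst.
  apply: sqr_lty_Lfun2; first exact: maX.
  by rewrite L_sqr// ltry.
have LZ r : Z r \in Lfun P 2%:E by exact: Lfun2_lincomb.
have XE r w : X w r = W r (X w) + Z r w by rewrite /W subrK.
have LW r : (fun w => W r (X w)) \in Lfun P 2%:E.
  rewrite (_ : (fun w => _) = fun w => -1 * Z r w + X w r).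
    exact: Lfun2_add_scale.
  by apply/funext => w; rewrite XE; ring.
have mcyl b : C0_dual T b -> measurable_fun [set: C0cyl T] (b : C0cyl T -> R).
  exact: dual_measurable_cyl.
(* Under the first reflection [W r] changes sign and [L i] does not. *)
have WL0 r i : (\int[P]_w (W r (X w) * L i (X w))%:E = 0)%E.
  apply: (reflection_principle T_gt0 X_gaussian X_generated
    (b := b1) (F := fun g => W r g * L i g) hb).
  - by apply: measurable_funM; exact: mcyl.
  - exact: Lfun2_mul_integrable.
  - move=> g1 g2 flip; rewrite (flip (W r) (-1))//.
    by rewrite (flip (L i) 1)//; ring.
(* Here only [e i] is reflected, which changes the sign of [L i] and fixes [L j]. *)
have LL0 i j : i != j -> (\int[P]_w (L i (X w) * L j (X w))%:E = 0)%E.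
  move=> ij; have [ei0|ei0] := eqVneq (e i) 0.
    by rewrite integral0_eq// => w _; rewrite (L0 i _ ei0) mul0r.
  apply: (reflection_principle T_gt0 X_gaussian X_generated
    (b := fun k => h k == e i) (F := fun g => L i g * L j g) hb).
  - by apply: measurable_funM; exact: mcyl.
  - exact: Lfun2_mul_integrable.
  - move=> g1 g2 flip; rewrite (flip (L i) (-1))// => [|k].
      rewrite (flip (L j) 1)// => [|k]; first by ring.
      rewrite Lu; case: eqP => [->|_]; last by rewrite expr0.
      by rewrite eo ?mulr0// eq_sym.
    rewrite Lu; case: eqP => [->|hk]; first by rewrite expr1.
    suff -> : inner (e i) (h k) = 0 by rewrite !mulr0.
    have [[m hm]|] := hcase k; last exact.
    by rewrite hm eo//; apply/eqP => im; apply: hk; rewrite hm im.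
(* [Z r] is measurable for the conditions, and by the first reflection the residual integrates to 0
   over each of their events. *)
have ZE r : is_cond_exp P (sigma_of_conditions X A) (fun w => X w r) (Z r).
  split.
  - pose G := [set E | exists b (B : set R),
        [/\ A b, measurable B & E = (b \o X) @^-1` B]].
    have mZ : measurable_fun [set: g_sigma_algebraType G]
        (Z r : g_sigma_algebraType G -> R).
      apply: measurable_sum => i; apply: measurable_funM => //.
      apply: measurable_sum => j; apply: measurable_funM => //.
      by move=> _ B mB; rewrite setTI; apply: sub_sigma_algebra; exists (a j), B.
    by move=> B mB; have := mZ measurableT B mB; rewrite setTI.
  - exact: Lfun2_integrable.
  - move=> E /sigma_of_conditionsE[D mD ED].
    have mDc := condition_events_cyl A_conditions mD.
    have mE : measurable E.
      rewrite ED -[X in measurable X]setTI.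
      exact: (process_measurable_cyl T_gt0 X_gaussian).
    have m1D : measurable_fun [set: C0cyl T] (\1_D : C0cyl T -> R).
      exact: measurable_indic.
    have iD : P.-integrable setT (fun w => (W r (X w) * \1_D (X w))%:E).
      apply: Lfun2_mul_integrable => //; apply: sqr_lty_Lfun2.
        apply: (measurableT_comp m1D).
        exact: (process_measurable_cyl T_gt0 X_gaussian).
      apply: (@le_lt_trans _ _ (\int[P]_w (cst 1 w))%E); last first.
        by rewrite integral_cst//= probability_setT mule1 ltry.
      apply: ge0_le_integral => //.
      + apply/measurable_EFinP; apply: measurable_funX.
        apply: (measurableT_comp m1D).
        exact: (process_measurable_cyl T_gt0 X_gaussian).
      + by move=> w _; rewrite lee_fin indicE; case: (_ \in _); rewrite ?expr1n ?expr0n.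
    have W0 : (\int[P]_(w in E) (W r (X w))%:E = 0)%E.
      transitivity (\int[P]_w (W r (X w) * \1_D (X w))%:E)%E.
        rewrite integral_mkcond; apply: eq_integral => w _.
        rewrite patchE ED indicE (_ : (w \in X @^-1` D) = (X w \in D))//.
        by case: (_ \in _); rewrite ?mulr1 ?mulr0.
      apply: (reflection_principle T_gt0 X_gaussian X_generated
        (b := b1) (F := fun g => W r g * \1_D g) hb) => //.
        by apply: measurable_funM => //; exact: mcyl.
      move=> g1 g2 flip; rewrite (flip (W r) (-1))//.
      have D12 : D g1 = D g2.
        apply: (condition_events_saturated (A := A)) => // b Ab.
        rewrite [RHS](flip b 1) ?mul1r// => [|k]; first exact: A_conditions.
        exact: b1A.
      have -> : \1_D g2 = \1_D g1 :> R.
        by rewrite !indicE; congr (nat_of_bool _)%:R; apply/idP/idP; rewrite !inE D12.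
      by rewrite mulN1r mulNr.
    rewrite [RHS](_ : _ = \int[P]_(w in E) ((W r (X w))%:E + (Z r w)%:E))%E.
      rewrite integralD//=; first by rewrite W0 add0e.
      + by apply: integrableS (Lfun2_integrable (LW r)).
      + by apply: integrableS (Lfun2_integrable (LZ r)).
    by apply: eq_integral => w _; rewrite XE EFinD.
(* With [Z s] and [Z t] as versions of the conditional expectations, the values of [XA] at [s] and
   [t] have the joint law of [W s] and [W t] applied to [X]. *)
have covXA : covariance_function P' XA s t = (\int[P]_w (W s (X w) * W t (X w))%:E)%E.
  rewrite /covariance_function unlock.
  pose st (k : 'I_2) := if k == 0 then s else t.
  have [XA_gauss lawXA] := XA_conditioned.
  have {}lawXA := lawXA 2 (fun k g => g (st k)) (fun k => eval_dual (st k))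
    (fun k => Z (st k)) (fun k => ZE (st k)).
  have m1 : measurable_fun [set: Omega'] (fun w => [tuple XA w (st k) | k < 2]).
    apply/measurable_fun_tnthP => k.
    rewrite (_ : _ \o _ = fun w => XA w (st k)).
      by have [] := gaussian_process_eval (st k) XA_gauss.
    by apply/funext => w /=; rewrite tnth_mktuple.
  have m2 : measurable_fun [set: Omega]
      (fun w => [tuple X w (st k) - Z (st k) w | k < 2]).
    apply/measurable_fun_tnthP => k.
    rewrite (_ : _ \o _ = fun w => W (st k) (X w)); first exact: maX.
    by apply/funext => w /=; rewrite tnth_mktuple.
  pose F (p : 2.-tuple R) := tnth p 0 * tnth p 1.
  have mF : measurable_fun [set: 2.-tuple R] F.
    by apply: measurable_funM; exact: measurable_tnth.
  have FE w : F [tuple X w (st k) - Z (st k) w | k < 2] = W s (X w) * W t (X w).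
    by rewrite /F !tnth_mktuple.
  transitivity (\int[P']_w (F [tuple XA w (st k) | k < 2])%:E)%E.
    by apply: eq_integral => w _; rewrite /F !tnth_mktuple.
  rewrite -(integral_same_law m2 m1 (fun B mB => esym (lawXA B mB)) mF).
    by apply: eq_integral => w _; rewrite FE.
  apply: (eq_integrable measurableT _ _ _ (Lfun2_mul_integrable (LW s) (LW t))).
  by move=> w _; rewrite FE.
have WZ0 r q : (\int[P]_w (W r (X w) * Z q w)%:E = 0)%E.
  rewrite (integral_mul_lincomb _ _ (LW r) LL) big1// => i _.
  by rewrite WL0 mule0.
(* The [L i (X w)] are orthogonal, with second moment 1 when [e i] is nonzero; otherwise
   [u (e i) = 0] removes the term. *)
have ZZ : (\int[P]_w (Z s w * Z t w)%:E = (\sum_(i < N) u (e i) s * u (e i) t)%:E)%E.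
  rewrite (integral_mul_lincomb _ _ (LZ s) LL) -sumEFin; apply: eq_bigr => i _.
  under eq_integral do rewrite mulrC.
  rewrite (integral_mul_lincomb _ _ (LL i) LL) (bigD1 i)//= big1 ?adde0.
    have [ei0|ei0] := eqVneq (e i) 0.
      have u0 q : u (e i) q = 0 by rewrite ei0 linear0.
      by rewrite !u0 !mul0e mul0r.
    under eq_integral do rewrite -expr2.
    by rewrite L_sqr// mule1 -EFinM mulrC.
  by move=> j ji; rewrite LL0 ?mule0// eq_sym.
(* The product of two sums [W + Z] is expanded and the mixed terms vanish. In the form of a sum, the
   finite second term can be cancelled in the extended reals. *)
have -> : covariance_function P X s t = ((\int[P]_w (W s (X w) * W t (X w))%:E) +
    (\sum_(i < N) u (e i) s * u (e i) t)%:E)%E.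
  rewrite /covariance_function unlock -ZZ.
  transitivity (\int[P]_w (((W s (X w) * W t (X w))%:E + (W s (X w) * Z t w)%:E) +
      ((W t (X w) * Z s w)%:E + (Z s w * Z t w)%:E)))%E.
    by apply: eq_integral => w _; rewrite !XE -!EFinD; congr EFin; ring.
  have i1 := Lfun2_mul_integrable (LW s) (LW t).
  have i2 := Lfun2_mul_integrable (LW s) (LZ t).
  have i3 := Lfun2_mul_integrable (LW t) (LZ s).
  have i4 := Lfun2_mul_integrable (LZ s) (LZ t).
  rewrite integralD//=; [|exact: integrableD|exact: integrableD].
  by rewrite !integralD//= !WZ0 adde0 add0e.
by rewrite covXA addeK.
Qed.
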